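(* Let $j\ge 1$, let $G_j$ be the $j$ times iterated wreath product of $\mathbb{Z}$ with $\mathbb{Z}$, and let $\mu_j$ be a switch-walk-switch symmetric finitely supported non-degenerate random walk on $G_j$, with drift function $L(n)$. Then the radius of almost invariance of $(G_j,\mu_j)$ is asymptotically strictly smaller than $n/L(n)$; that is, there is a function $\rho(n)>0$ with $\rho(n)\big/\bigl(n/L(n)\bigr)\to 0$ as $n\to\infty$ such that $r_{\rm a.i.}(G_j,\mu_j)(n)\preceq\rho(n)$.
   Context: The wreath product $A\wr B$ is the semidirect product of $A$ and $\sum_A B$ (finitely supported functions $A\to B$), where $A$ acts by shifts; $A$ and $B$ are embedded in $A\wr B$ in the standard way ($B$ as functions supported at $e_A$). Set $G_0=\mathbb{Z}$ and $G_j=\mathbb{Z}\wr G_{j-1}$ for $j\ge 1$. A switch-walk-switch random walk on $A\wr B$ is given by $\mu=\mu_B*\mu_A*\mu_B$ with $\mu_A,\mu_B$ probability measures on $A$ and $B$; on $G_j$ this is applied at each level: $\mu_j=\mu_{j-1}*\nu_j*\mu_{j-1}$, where $\nu_j$ is a symmetric finitely supported measure on the acting group $\mathbb{Z}$ and $\mu_{j-1}$ is a measure of the same kind on $G_{j-1}$, with $\mu_0$ a symmetric finitely supported measure on $\mathbb{Z}$; non-degenerate means that the support of each of the measures on $\mathbb{Z}$ involved generates $\mathbb{Z}$. Let $G$ be generated by a finite set $S$, with word length $l_S$. The drift function is $L(n)=\sum_{g\in G}l_S(g)\mu^{*n}(g)$. For $r:\mathbb{N}\to[0,\infty)$, $(G,\mu)$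 has almost invariant distributions on the scale $r(n)$ if for every $\epsilon>0$ and all sufficiently large $n$ there is $V_{\epsilon,n}\subset G$ with $\mu^{*n}(V_{\epsilon,n})\ge 1-\epsilon$ such that for all $h\in V_{\epsilon,n}$ and all $g\in G$ with $l_S(g)\le r(n)$ one has $\mu^{*n}(h)>0$ and $|\mu^{*n}(hg)/\mu^{*n}(h)-1|\le\epsilon$. The relation $r_{\rm a.i.}(G,\mu)(n)\preceq r(n)$ means: for any function $r'(n)$ such that $r'(n)/r(n)$ tends to infinity on some subsequence, $(G,\mu)$ does not have almost invariant distributions on the scale $r'(n)$. *)

(* Defs.v *)
From HB Require Import structures.
From mathcomp Require Import all_boot all_order all_algebra finmap.
From mathcomp Require Import all_classical all_reals all_analysis.

Set Implicit Arguments.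
Unset Strict Implicit.
Unset Printing Implicit Defensive.

Import Order.TTheory GRing.Theory Num.Theory.
Import numFieldNormedType.Exports.

Local Open Scope classical_set_scope.
Local Open Scope fset_scope.
Local Open Scope ring_scope.

(* [wreath A B] is the restricted wreath product "A wr B" with the ACTING group
   written first: pairs (a, f) with f : A -> B finitely supported, where A acts
   on the functions by (a . f) x = f (a^-1 x) and
   (a, f) (a', f') = (a a', f * (a . f')). *)
Record wreath (A B : groupType) := Wreath {
  wr_base : A;
  wr_lamp : {fsfun A -> B with 1%g}
}.

Section WreathGroup.
Context {A B : groupType}.
Implicit Types u v w : wreath A B.

Definition wreath_pair u := (wr_base u, wr_lamp u).
Definition pair_wreath (p : A * {fsfun A -> B with 1%g}) : wreath A B :=
  Wreath p.1 p.2.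

Lemma wreath_pairK : cancel wreath_pair pair_wreath.
Proof. by case. Qed.

HB.instance Definition _ :=
  Choice.copy (wreath A B) (can_type wreath_pairK).

Definition wr_one : wreath A B := Wreath 1%g [fsfun].

Definition wr_mul u v : wreath A B :=
  Wreath (wr_base u * wr_base v)%g
    [fsfun x in finsupp (wr_lamp u) `|`
                [fset (wr_base u * y)%g | y in finsupp (wr_lamp v)] =>
       (wr_lamp u x * wr_lamp v ((wr_base u)^-1 * x))%g | 1%g].

Definition wr_inv u : wreath A B :=
  Wreath (wr_base u)^-1%g
    [fsfun x in [fset ((wr_base u)^-1 * y)%g | y in finsupp (wr_lamp u)] =>
       ((wr_lamp u (wr_base u * x))^-1)%g | 1%g].

Lemma wreath_eq u v :
  wr_base u = wr_base v -> wr_lamp u =1 wr_lamp v -> u = v.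
Proof. by case: u v => [a f] [b g] /= -> /fsfunP ->. Qed.

Lemma wr_mulE u v x :
  wr_lamp (wr_mul u v) x = (wr_lamp u x * wr_lamp v ((wr_base u)^-1 * x))%g.
Proof.
rewrite fsfun_fun; case: ifP => // /negbT; rewrite in_fsetU negb_or.
move=> /andP[xu xv]; rewrite (fsfun_dflt xu) mul1g fsfun_dflt //.
apply: contra xv => xv; apply/imfsetP.
by exists ((wr_base u)^-1 * x)%g => //; rewrite mulVKg.
Qed.

Lemma wr_invE u x :
  wr_lamp (wr_inv u) x = ((wr_lamp u (wr_base u * x))^-1)%g.
Proof.
rewrite fsfun_fun; case: ifP => // /negbT xu.
rewrite fsfun_dflt ?invg1 //; apply: contra xu => xu.
by apply/imfsetP; exists (wr_base u * x)%g => //; rewrite mulKg.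
Qed.

Lemma wr_oneE x : wr_lamp wr_one x = 1%g.
Proof. by rewrite fsfun0E. Qed.

Lemma wr_mulA : associative wr_mul.
Proof.
move=> u v w; apply: wreath_eq => [|x]; first exact: mulgA.
by rewrite !wr_mulE /= invgM !mulgA.
Qed.

Lemma wr_mul1 : left_id wr_one wr_mul.
Proof.
move=> u; apply: wreath_eq => [|x]; first exact: mul1g.
by rewrite wr_mulE wr_oneE /= invg1 !mul1g.
Qed.

Lemma wr_mulr1 : right_id wr_one wr_mul.
Proof.
move=> u; apply: wreath_eq => [|x]; first exact: mulg1.
by rewrite wr_mulE wr_oneE mulg1.
Qed.

Lemma wr_mulV : left_inverse wr_one wr_inv wr_mul.
Proof.
move=> u; apply: wreath_eq => [|x]; first exact: mulVg.
by rewrite wr_mulE wr_invE wr_oneE /= invgK mulVg.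
Qed.

Lemma wr_mulrV : right_inverse wr_one wr_inv wr_mul.
Proof.
move=> u; apply: wreath_eq => [|x]; first exact: mulgV.
by rewrite wr_mulE wr_invE wr_oneE mulVKg mulgV.
Qed.

HB.instance Definition _ := isGroup.Build (wreath A B)
  wr_mulA wr_mul1 wr_mulr1 wr_mulV wr_mulrV.

Definition wr_acting (a : A) : wreath A B := Wreath a [fsfun].

Definition wr_delta (b : B) : wreath A B :=
  Wreath 1%g [fsfun x in [fset 1%g] => b | 1%g].

End WreathGroup.

Definition Zgroup : groupType := Algebra.to_multiplicative int.

Fixpoint iter_wreath (j : nat) : groupType :=
  if j is j'.+1 then wreath Zgroup (iter_wreath j') else Zgroup.

Section WordLength.
Context {G : groupType}.
Implicit Types (S : {fset G}) (w : seq G) (g : G).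

Definition word_of S w g :=
  all (fun x => (x \in S) || (x^-1%g \in S)) w /\ (\prod_(x <- w) x)%g = g.

Definition generates S := forall g, exists w, word_of S w g.

Definition word_lengths S g : set nat :=
  [set n | exists2 w, word_of S w g & size w = n].

(* The default value 0 is only used when g is not in the subgroup
   generated by S. *)
Definition word_length S g : nat :=
  xget 0%N [set n | word_lengths S g n /\ lbound (word_lengths S g) n].

End WordLength.

Section FiniteMeasures.
Context {R : realType}.

Notation "{ 'fsmeas' G }" := {fsfun G -> R with 0}.

Section OneGroup.
Context {G : groupType}.
Implicit Types (mu nu : {fsmeas G}) (g : G).

Definition prob_meas mu :=
  (forall g, 0 <= mu g) /\ \sum_(g <- finsupp mu) mu g = 1.

Definition symmetric_meas mu := forall g, mu g^-1%g = mu g.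

Definition dirac1 : {fsmeas G} := [fsfun g in [fset 1%g] => 1 | 0].

Definition convolve mu nu : {fsmeas G} :=
  [fsfun g in [fset (x * y)%g | x in finsupp mu, y in finsupp nu] =>
     \sum_(x <- finsupp mu) mu x * nu (x^-1 * g)%g | 0].

Lemma convolveE mu nu g :
  convolve mu nu g = \sum_(x <- finsupp mu) mu x * nu (x^-1 * g)%g.
Proof.
rewrite fsfun_fun; case: ifP => // /negbT gN.
rewrite big_seq big1 // => x xmu; rewrite [nu _]fsfun_dflt ?mulr0 //.
apply: contra gN => gnu; apply/imfset2P.
by exists x => //; exists (x^-1 * g)%g => //; rewrite mulVKg.
Qed.

Definition convolve_pow mu n : {fsmeas G} := iter n (convolve mu) dirac1.

Definition mass mu (V : set G) : R := \sum_(g <- finsupp mu | g \in V) mu g.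

Definition drift (S : {fset G}) mu (n : nat) : R :=
  \sum_(g <- finsupp (convolve_pow mu n))
    (word_length S g)%:R * convolve_pow mu n g.

Definition almost_invariant (S : {fset G}) mu (r : nat -> R) :=
  forall eps : R, 0 < eps -> \forall n \near \oo,
    exists V : set G, 1 - eps <= mass (convolve_pow mu n) V /\
      forall h g, V h -> (word_length S g)%:R <= r n ->
        0 < convolve_pow mu n h /\
        `|convolve_pow mu n (h * g)%g / convolve_pow mu n h - 1| <= eps.

(* The relation "r_ai(G, mu)(n) is dominated by r(n)"; "r' / r tends to infinity
   on some subsequence" is witnessed by a strictly increasing phi. *)
Definition radius_ai_preceq (S : {fset G}) mu (r : nat -> R) :=
  forall r' : nat -> R, (forall n, 0 <= r' n) ->
    (exists phi : nat -> nat, {homo phi : m n / (m < n)%N} /\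
       (fun n => r' (phi n) / r (phi n)) @ \oo --> +oo) ->
    ~ almost_invariant S mu r'.

End OneGroup.

Definition push_meas {G H : groupType} (f : G -> H) (mu : {fsmeas G}) :
    {fsmeas H} :=
  [fsfun h in [fset f g | g in finsupp mu] =>
     \sum_(g <- finsupp mu | f g == h) mu g | 0].

Definition switch_walk_switch {A B : groupType}
    (muA : {fsmeas A}) (muB : {fsmeas B}) : {fsmeas wreath A B} :=
  convolve (convolve (push_meas wr_delta muB) (push_meas wr_acting muA))
       (push_meas wr_delta muB).

(* nu 0 is the initial measure mu_0 and, for i > 0, nu i is the walking measure
   on the acting copy of Z at level i. *)
Fixpoint sws_walk (nu : nat -> {fsmeas Zgroup}) (j : nat) :
    {fsmeas iter_wreath j} :=
  if j is j'.+1 then switch_walk_switch (nu j'.+1) (sws_walk nu j') else nu 0%N.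

Definition nondegenerate_step (nu : {fsmeas Zgroup}) :=
  [/\ prob_meas nu, symmetric_meas nu & generates (finsupp nu)].

End FiniteMeasures.

(* Main.v *)
Require Import Defs.
From HB Require Import structures.
From mathcomp Require Import all_boot all_order all_algebra finmap.
From mathcomp Require Import all_classical all_reals all_analysis.
From mathcomp Require Import ring lra zify.

Set Implicit Arguments.
Unset Strict Implicit.
Unset Printing Implicit Defensive.

Import Order.TTheory GRing.Theory Num.Theory.
Import numFieldNormedType.Exports.

Local Open Scope classical_set_scope.
Local Open Scope ring_scope.

(** Let s_j(n) = n^(2^(-j-1)). Two facts are combined: the drift of G_j is at most
   of order n / s_j(n), and for every c > 0 invariance at precision one half on
   the radius c s_j(n) fails for all large n. The largest admissible radius at
   precision one half is then o(s_j(n)), hence o(n / L(n)), and serves as rho.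

   The drift bound is an induction on the level ([drift_growth]). To write an
   element, tour the range of the base walk, of size sqrt n, and repair the lamp
   of each site; the lamp at y is the inner walk at time t_y, the t_y add up to
   2n, and concavity of the inner growth bounds the total.

   For the radius the key is that g may be chosen depending on h. Descend from
   the top of G_j to the copy of the wreath product of the integers by themselves
   that sits at the current position of every level ([current]), and look at
   its integer lamps at m sites near the walker. Multiplying h by a suitable g of
   length at most c s_j(n) raises the largest of these m values by k, where k is
   of order s_j(n). This map is injective, and its image consists of
   configurations in which one site leads all others by at least k. If almost
   invariance held, the image would have probability at least one quarter
   ([translated_mass]). But the m values are nearly independent and identically
   distributed with Gaussian tails on the scale s_j(n), and the gap between the
   two largest of m such values is small compared to this scale when m is large
   ([level_one_gap], [current_gap]): a maximum fluctuates less than a single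
   value.

   Three estimates make the last step rigorous. The numbers of switches at
   nearby sites are almost equal ([path_visits_flat]), because the potential
   kernel of a symmetric walk telescopes against its return probabilities. These
   are of order 1 / sqrt n by a Nash inequality ([pow_sup_bound]), which also
   bounds the mean number of switches at a site. The tail of an integer walk
   loses a large factor over a stretch of length k ([hazard]), by a Stein identity.
   Independence of the lamps given the base path is used in the form of
   resampling one lamp at a time ([joint_reset]). *)

(** * Expectations *)

(* Keeps simplification from turning powers into explicit convolutions. *)
Local Arguments convolve_pow : simpl never.


Section Expectation.
Context {R : realType}.

Definition expect {T : choiceType} (mu : {fsfun T -> R with 0}) (F : T -> R) : R :=
  \sum_(x <- finsupp mu) mu x * F x.

Section Basic.
Context {T : choiceType}.
Implicit Types (mu : {fsfun T -> R with 0}) (F G : T -> R).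

Lemma expect_widen (X : {fset T}) mu F : (finsupp mu `<=` X)%fset ->
  expect mu F = \sum_(x <- X) mu x * F x.
Proof.
move=> sX; apply: big_fset_incl => // x _ xN.
by rewrite fsfun_dflt // mul0r.
Qed.

Lemma eq_expect mu F G : F =1 G -> expect mu F = expect mu G.
Proof. by move=> FG; apply: eq_bigr => x _; rewrite FG. Qed.

Lemma expect_eq0 mu F : (forall x, F x = 0) -> expect mu F = 0.
Proof. by move=> F0; rewrite /expect big1 // => x _; rewrite F0 mulr0. Qed.

Lemma expectD mu F G :
  expect mu (fun x => F x + G x) = expect mu F + expect mu G.
Proof. by rewrite -big_split; apply: eq_bigr => x _; rewrite mulrDr. Qed.

Lemma expectZ mu c F : expect mu (fun x => c * F x) = c * expect mu F.
Proof. by rewrite mulr_sumr; apply: eq_bigr => x _; rewrite mulrCA. Qed.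

Lemma expectZr mu c F : expect mu (fun x => F x * c) = expect mu F * c.
Proof. by rewrite mulr_suml; apply: eq_bigr => x _; rewrite mulrA. Qed.

Lemma expectN mu F : expect mu (fun x => - F x) = - expect mu F.
Proof. by rewrite -sumrN; apply: eq_bigr => x _; rewrite mulrN. Qed.

Lemma expectB mu F G :
  expect mu (fun x => F x - G x) = expect mu F - expect mu G.
Proof. by rewrite expectD expectN. Qed.

Lemma expect_sum mu (I : Type) (r : seq I) (P : pred I) (F : I -> T -> R) :
  expect mu (fun x => \sum_(i <- r | P i) F i x) =
  \sum_(i <- r | P i) expect mu (F i).
Proof.
rewrite /expect exchange_big /=.
by apply: eq_bigr => x _; rewrite mulr_sumr.
Qed.

Lemma expect_point mu x : expect mu (fun z => (z == x)%:R) = mu x.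
Proof.
rewrite (@expect_widen (x |` finsupp mu)%fset) ?fsubsetUr //.
rewrite (big_fsetD1 x) ?fset1U1 //= eqxx mulr1 big1_fset ?addr0 // => y.
by rewrite in_fsetD1 => /andP[/negPf -> _] _; rewrite mulr0.
Qed.

Lemma ler_expect mu F G : (forall x, 0 <= mu x) ->
  (forall x, x \in finsupp mu -> F x <= G x) -> expect mu F <= expect mu G.
Proof.
move=> mu0 FG; rewrite /expect big_seq [leRHS]big_seq; apply: ler_sum => x xm.
by rewrite ler_wpM2l ?FG.
Qed.

End Basic.

Lemma exchange_expect {T U : choiceType} (mu : {fsfun T -> R with 0})
    (nu : {fsfun U -> R with 0}) (F : T -> U -> R) :
  expect mu (fun x => expect nu (F x)) =
  expect nu (fun y => expect mu (fun x => F x y)).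
Proof.
rewrite /expect.
under eq_bigr do rewrite mulr_sumr.
rewrite exchange_big /=; apply: eq_bigr => y _; rewrite mulr_sumr.
by apply: eq_bigr => x _; rewrite mulrCA.
Qed.

Section OnGroups.
Context {G H : groupType}.
Implicit Types (mu nu : {fsfun G -> R with 0}) (F : G -> R).

(** Sums over a set that contains the translated support can be computed after
   translation: the change of variables behind convolutions and Gram sums. *)
Lemma sum_translate (x : G) nu F (X : {fset G}) :
  (forall y, y \in finsupp nu -> (x * y)%g \in X) ->
  \sum_(z <- X) nu (x^-1 * z)%g * F z = expect nu (fun y => F (x * y)%g).
Proof.
move=> sX; have xinj : injective (fun y => x * y)%g by exact: mulgI.
have -> : expect nu (fun y => F (x * y)%g) =
  \sum_(z <- [fset (x * y)%g | y in finsupp nu]%fset) nu (x^-1 * z)%g * F z.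
  rewrite big_imfset /=; last by move=> ? ? _ _; exact: xinj.
  by apply: eq_bigr => y _; rewrite mulKg.
apply/esym/big_fset_incl.
  by apply/fsubsetP => _ /imfsetP[y /= /sX yX ->].
move=> z _ zN; rewrite fsfun_dflt ?mul0r //; apply: contra zN => zN.
by apply/imfsetP; exists (x^-1 * z)%g; rewrite ?mulVKg.
Qed.

Lemma expect_convolve mu nu F : expect (convolve mu nu) F =
  expect mu (fun x => expect nu (fun y => F (x * y)%g)).
Proof.
pose X := [fset (x * y)%g | x in finsupp mu, y in finsupp nu]%fset.
rewrite (@expect_widen _ X); last first.
  by apply/fsubsetP => g; apply: contraTT => gX; rewrite memNfinsupp fsfun_fun (negPf gX).
under eq_bigr do rewrite convolveE mulr_suml.
rewrite exchange_big /expect big_seq [RHS]big_seq /=.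
apply: eq_bigr => x xm; rewrite -/(expect nu _).
rewrite -(@sum_translate x nu F X).
  by rewrite mulr_sumr; apply: eq_bigr => z _; rewrite mulrA.
by move=> y ym; apply/imfset2P; exists x => //; exists y.
Qed.

Lemma expect_dirac1 F : expect (@dirac1 R G) F = F 1%g.
Proof.
rewrite (@expect_widen _ [fset 1%g]%fset).
  by rewrite big_seq_fset1 fsfun_fun in_fset1 eqxx mul1r.
apply/fsubsetP => g; apply: contraTT => gX.
by rewrite memNfinsupp fsfun_fun (negPf gX).
Qed.

Lemma expect_push (f : G -> H) mu (F : H -> R) :
  expect (push_meas f mu) F = expect mu (fun x => F (f x)).
Proof.
pose X := [fset f g | g in finsupp mu]%fset.
rewrite (@expect_widen _ X); last first.
  by apply/fsubsetP => g; apply: contraTT => gX; rewrite memNfinsupp fsfun_fun (negPf gX).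
transitivity (\sum_(h <- X) \sum_(g <- finsupp mu | f g == h) mu g * F (f g)).
  rewrite big_seq [RHS]big_seq; apply: eq_bigr => h hX.
  rewrite fsfun_fun hX mulr_suml; apply: eq_bigr => g /eqP ->; ring.
rewrite (exchange_big_dep xpredT) //= /expect big_seq [RHS]big_seq.
apply: eq_bigr => g gm.
have fX : f g \in X by apply/imfsetP; exists g.
rewrite big_mkcond (big_fsetD1 (f g)) //= eqxx big1_fset ?addr0 // => i.
by rewrite in_fsetD1 eq_sym => /andP[/negPf ->].
Qed.

Lemma expect_cst mu c : prob_meas mu -> expect mu (fun=> c) = c.
Proof. by move=> [_ m1]; rewrite /expect -mulr_suml m1 mul1r. Qed.

Lemma prob_measP mu : (forall g, 0 <= mu g) -> expect mu (fun=> 1) = 1 ->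
  prob_meas mu.
Proof.
move=> m0 m1; split => //; rewrite -[RHS]m1 /expect.
by under [RHS]eq_bigr do rewrite mulr1.
Qed.

Lemma expect_ge0 mu F : prob_meas mu -> (forall x, 0 <= F x) ->
  0 <= expect mu F.
Proof. by move=> [m0 _] F0; apply: sumr_ge0 => x _; rewrite mulr_ge0. Qed.

Lemma prob_convolve mu nu :
  prob_meas mu -> prob_meas nu -> prob_meas (convolve mu nu).
Proof.
move=> pm pn; apply: prob_measP => [g|]; last first.
  by rewrite expect_convolve; under eq_expect do rewrite expect_cst //; rewrite expect_cst.
rewrite convolveE; apply: sumr_ge0 => x _.
by case: pm pn => m0 _ [n0 _]; rewrite mulr_ge0.
Qed.

Lemma prob_dirac1 : prob_meas (@dirac1 R G).
Proof.
apply: prob_measP => [g|]; last by rewrite expect_dirac1.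
by rewrite fsfun_fun; case: ifP.
Qed.

Lemma prob_convolve_pow mu n : prob_meas mu -> prob_meas (convolve_pow mu n).
Proof.
by move=> pm; elim: n => [|n IH]; [exact: prob_dirac1|exact: prob_convolve].
Qed.

Lemma prob_meas_le1 mu g : prob_meas mu -> mu g <= 1.
Proof.
move=> pm; rewrite -[leRHS](expect_cst 1 pm) -[leLHS](expect_point mu).
by apply: ler_expect => [|x _]; [case: pm|case: eqP].
Qed.

Lemma expect_sym mu F : symmetric_meas mu ->
  expect mu F = expect mu (fun x => F x^-1%g).
Proof.
move=> ms.
have -> : expect mu (fun x => F x^-1%g) =
    \sum_(x <- [fset y^-1%g | y in finsupp mu]%fset) mu x * F x.
  rewrite big_imfset /=; last by move=> ? ? _ _; exact: invg_inj.
  by apply: eq_bigr => y _; rewrite ms.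
apply: expect_widen; apply/fsubsetP => x xm; apply/imfsetP.
by exists x^-1%g; rewrite ?invgK //= mem_finsupp ms -mem_finsupp.
Qed.

Lemma convolve_pow1 mu g : convolve_pow mu 1 g = mu g.
Proof.
rewrite -expect_point expect_convolve.
by under eq_expect do rewrite expect_dirac1 mulg1; rewrite expect_point.
Qed.

Lemma expect_powS mu n F : expect (convolve_pow mu n.+1) F =
  expect mu (fun x => expect (convolve_pow mu n) (fun y => F (x * y)%g)).
Proof. exact: expect_convolve. Qed.

Lemma expect_powD mu m n F : expect (convolve_pow mu (m + n)) F =
  expect (convolve_pow mu m) (fun x =>
    expect (convolve_pow mu n) (fun y => F (x * y)%g)).
Proof.
elim: m F => [|m IH] F.
  by rewrite add0n expect_dirac1; apply: eq_expect => y; rewrite mul1g.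
rewrite addSn !expect_powS; apply: eq_expect => x; rewrite IH.
by apply: eq_expect => y; apply: eq_expect => z; rewrite mulgA.
Qed.

Lemma expect_pow1 mu F : expect (convolve_pow mu 1) F = expect mu F.
Proof.
by rewrite expect_powS; apply: eq_expect => x; rewrite expect_dirac1 mulg1.
Qed.

(** Powers can be unrolled from the right as well: this is what lets a walk be
   followed relative to its current position. *)
Lemma expect_powSr mu n F : expect (convolve_pow mu n.+1) F =
  expect (convolve_pow mu n) (fun y => expect mu (fun x => F (y * x)%g)).
Proof.
by rewrite -addn1 expect_powD; apply: eq_expect => y; rewrite expect_pow1.
Qed.

Lemma convolve_powD mu m n z : convolve_pow mu (m + n) z =
  expect (convolve_pow mu m) (fun x => convolve_pow mu n (x^-1 * z)%g).
Proof.
rewrite -expect_point expect_powD; apply: eq_expect => x.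
rewrite -expect_point; apply: eq_expect => y; congr (_%:R).
by rewrite (can2_eq (mulKg x) (mulVKg x)).
Qed.

Lemma convolve_powS mu n z : convolve_pow mu n.+1 z =
  expect mu (fun x => convolve_pow mu n (x^-1 * z)%g).
Proof. exact: convolveE. Qed.

Lemma symmetric_pow mu n : symmetric_meas mu -> symmetric_meas (convolve_pow mu n).
Proof.
move=> ms; elim: n => [|n IH] g.
  by rewrite !fsfun_fun !in_fset1 (can2_eq invgK invgK) invg1.
rewrite -expect_point expect_powSr exchange_expect convolve_powS.
rewrite (expect_sym _ ms); apply: eq_expect => x.
rewrite -IH -expect_point; apply: eq_expect => y; congr (_%:R).
by rewrite invgM invgK (can2_eq (mulgVK x) (mulgK x)).
Qed.

Lemma mass_expect mu (V : set G) : mass mu V = expect mu (fun g => (g \in V)%:R).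
Proof.
rewrite /mass /expect big_mkcond; apply: eq_bigr => g _.
by case: (g \in V); rewrite ?mulr1 ?mulr0.
Qed.

End OnGroups.
End Expectation.

(** * Return probabilities of symmetric walks *)

Lemma sum_eq_le1 {R : realType} {T : eqType} (ys : seq T) (x : T) :
  uniq ys -> \sum_(y <- ys) (y == x)%:R <= 1 :> R.
Proof.
move=> /count_uniq_mem cu; rewrite -natr_sum -[leRHS]/(1%:R) ler_nat.
rewrite (eq_bigr (fun y => if y == x then 1%N else 0%N)); last first.
  by move=> y _; case: eqP.
by rewrite -big_mkcond sum1_count cu leq_b1.
Qed.

Section ReturnProbabilities.
Context {R : realType} {G : groupType} (nu : {fsfun G -> R with 0}).
Hypotheses (nu_prob : prob_meas nu) (nu_sym : symmetric_meas nu).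

Local Notation p := (convolve_pow nu).

Lemma pow_ge0 n z : 0 <= p n z.
Proof. by case: (prob_convolve_pow n nu_prob). Qed.

Lemma pow_le1 n z : p n z <= 1.
Proof. exact: prob_meas_le1 (prob_convolve_pow n nu_prob). Qed.

Lemma powV n z : p n z^-1%g = p n z.
Proof. exact: symmetric_pow. Qed.

(** By symmetry, [p (a + b) (x^-1 * y)] is the inner product of the law after
   [a] steps translated by [x] with the law after [b] steps translated by [y].
   The sum is therefore the squared norm of a combination of translated laws;
   every inequality on return probabilities below is an instance. *)
Lemma pow_gram_ge0 (L : seq (R * nat * G)) :
  0 <= \sum_(u <- L) \sum_(v <- L)
         u.1.1 * v.1.1 * p (u.1.2 + v.1.2) (u.2^-1 * v.2)%g.
Proof.
have [X XP] : exists X : {fset G}, forall u, u \in L ->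
    forall y, y \in finsupp (p u.1.2) -> (u.2 * y)%g \in X.
  elim: L => [|u L [X XP]]; first by exists fset0.
  exists ([fset (u.2 * y)%g | y in finsupp (p u.1.2)] `|` X)%fset => v.
  rewrite inE => /predU1P[-> y ym|vL y ym]; rewrite in_fsetU.
    by apply/orP; left; apply/imfsetP; exists y.
  by rewrite (XP v) ?orbT.
have -> : \sum_(u <- L) \sum_(v <- L)
         u.1.1 * v.1.1 * p (u.1.2 + v.1.2) (u.2^-1 * v.2)%g =
    \sum_(z <- X) (\sum_(u <- L) u.1.1 * p u.1.2 (u.2^-1 * z)%g) ^+ 2.
  transitivity (\sum_(z <- X) \sum_(u <- L) \sum_(v <- L)
      (u.1.1 * p u.1.2 (u.2^-1 * z)%g) * (v.1.1 * p v.1.2 (v.2^-1 * z)%g)).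
    2: by apply: eq_bigr => z _; rewrite expr2 mulr_suml; apply: eq_bigr => u _;
          rewrite mulr_sumr.
  rewrite [RHS]exchange_big /= big_seq [RHS]big_seq; apply: eq_bigr => u uL.
  rewrite exchange_big /=; apply: eq_bigr => v _.
  rewrite convolve_powD.
  transitivity (u.1.1 * v.1.1 *
    \sum_(z <- X) p u.1.2 (u.2^-1 * z)%g * p v.1.2 (v.2^-1 * z)%g).
    congr (_ * _); rewrite (sum_translate _ (XP u uL)).
    by apply: eq_expect => x; rewrite -powV !invgM !invgK mulgA.
  by rewrite mulr_sumr; apply: eq_bigr => z _; ring.
by apply: sumr_ge0 => z _; exact: sqr_ge0.
Qed.

Let u m := p (m + m) 1%g.
(** Half the squared distance of the law after m steps to its translate. *)
Let D m z := u m - p (m + m) z.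

Lemma even_pow_le m z : p (m + m) z <= p (m + m) 1%g.
Proof.
have := pow_gram_ge0 [:: (1, m, 1%g); (-1, m, z)].
rewrite !big_cons !big_nil /= mulVg invg1 mul1g mulg1 mulVg powV; lra.
Qed.

Let D_ge0 m z : 0 <= D m z.
Proof. by rewrite subr_ge0 even_pow_le. Qed.

(** The defect at an odd time is a scalar product of the translation defects of
   two consecutive laws, so polarization bounds it by the two even defects. *)
Lemma odd_pow_defect m z : p (m + m).+1 1%g - p (m + m).+1 z <=
  2^-1 * (D m z + D m.+1 z).
Proof.
have := pow_gram_ge0
  [:: (1, m.+1, 1%g); (-1, m.+1, z); (-1, m, 1%g); (1, m, z)].
rewrite !big_cons !big_nil /= !mulVg !invg1 !mul1g !mulg1 !powV.
rewrite /D /u !addSn !addnS. lra.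
Qed.

Section Direction.
Variable (d : G).

(** The defect is half a squared distance between translates, and [d ^+ i] is
   reached by [i] translations of the same length. The induction uses the
   triangle inequality with weights 1 + 1/i and 1 + i, as squared norms demand. *)
Lemma pow_defect_scale m i : D m (d ^+ i)%g <= i%:R ^+ 2 * D m d.
Proof.
elim: i => [|i IH]; first by rewrite expg0 /D subrr expr2 !mul0r.
case: i IH => [|i] IH; first by rewrite expg1 expr1n mul1r.
set I : R := i.+1%:R in IH *.
have I0 : 0 < I by rewrite ltr0n.
have -> : i.+2%:R = I + 1 :> R by rewrite -natr1.
have := pow_gram_ge0 [:: (1, m, 1%g); (-(1 + I), m, (d ^+ i.+1)%g);
                         (I, m, (d ^+ i.+2)%g)].
rewrite !big_cons !big_nil /= !mulVg !invg1 !mul1g !mulg1 !powV.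
have -> : ((d ^+ i.+1)^-1 * d ^+ i.+2)%g = d by rewrite (expgSr d i.+1) mulKg.
have -> : ((d ^+ i.+2)^-1 * d ^+ i.+1)%g = d^-1%g.
  by rewrite (expgSr d i.+1) invgM mulgVK.
rewrite powV => H.
have E : I * D m (d ^+ i.+2)%g <=
   (1 + I) * D m (d ^+ i.+1)%g + I * (1 + I) * D m d by rewrite /D /u; lra.
have := D_ge0 m d => D0.
rewrite -(ler_pM2l I0); apply: (le_trans E); nra.
Qed.

Let q := p 2 d.

(** The mean defect after two more steps is exactly the loss in return
   probability, and [d] is one of the terms of this mean. *)
Lemma pow_defect_step m : q * D m d <= u m - u m.+1.
Proof.
have -> : u m - u m.+1 = expect (p 2) (fun z => D m z).
  rewrite expectB expect_cst; last exact: prob_convolve_pow.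
  congr (_ - _); rewrite /u.
  have -> : (m.+1 + m.+1 = 2 + (m + m))%N by lia.
  rewrite convolve_powD; apply: eq_expect => x.
  by rewrite mulg1 powV.
rewrite (@expect_widen _ _ (d |` finsupp (p 2))%fset) ?fsubsetUr //.
rewrite (big_fsetD1 d) ?fset1U1 //= lerDl; apply: sumr_ge0 => z _.
by rewrite mulr_ge0 ?pow_ge0.
Qed.

Let u_nincr m : 0 <= u m - u m.+1.
Proof.
by apply: le_trans (pow_defect_step m); rewrite mulr_ge0 // pow_ge0.
Qed.

Hypothesis (q_gt0 : 0 < p 2 d).

(** The potential kernel in direction [d] is bounded, however recurrent the walk:
   the defects telescope against the return probabilities. *)
Lemma sum_pow_defect n : \sum_(i < n) (p i 1%g - p i d) <= 4 / p 2 d.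
Proof.
(* Every return probability occurs twice in U, and an odd defect reaches two
   even steps ahead: hence a telescoping with lag four. *)
pose U i := u i./2.
have Ud i : p i 1%g - p i d <= (U i - U (i + 4)%N) / q.
  rewrite ler_pdivlMr // mulrC /U.
  have -> : (i + 4)%N./2 = (i./2).+2 by rewrite halfD andbF /= addn2.
  have [b [m [-> ]]] : exists b m, i = ((m + m) + b)%N /\ (b <= 1)%N.
    exists (odd i : nat), (i./2); split; last by case: odd.
    by rewrite addnn addnC odd_double_half.
  case: b => [|[|//]] _.
    have -> : ((m + m) + 0)./2 = m by lia.
    rewrite addn0 -/(u m) -/(D m d).
    have := pow_defect_step m; have := u_nincr m.+1; lra.
  have -> : ((m + m) + 1)./2 = m by lia.
  rewrite addn1.
  have := odd_pow_defect m d; rewrite -(ler_pM2l q_gt0) -/q.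
  have := pow_defect_step m; have := pow_defect_step m.+1.
  have := u_nincr m; have := u_nincr m.+1; lra.
have S : \sum_(i < n) (p i 1%g - p i d) <=
    (4 - (U n + U n.+1 + U n.+2 + U n.+3)) / q.
  elim: n => [|n IH].
    rewrite big_ord0 divr_ge0 ?pow_ge0 // /U /=.
    have := pow_le1 0 1%g; have := pow_le1 2 1%g; rewrite /u /=; lra.
  rewrite big_ord_recr /=; apply: le_trans (lerD IH (Ud n)) _.
  rewrite -mulrDl ler_pM2r ?invr_gt0 // addn4; lra.
apply: le_trans S _; rewrite ler_pM2r ?invr_gt0 //.
by have [] := (pow_ge0 (n./2 + n./2) 1%g, pow_ge0 (n.+1./2 + n.+1./2) 1%g);
   have [] := (pow_ge0 (n.+2./2 + n.+2./2) 1%g, pow_ge0 (n.+3./2 + n.+3./2) 1%g);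
   rewrite /U /u; lra.
Qed.

Hypothesis (d_free : injective (fun i : nat => d ^+ i)%g).

(** One-dimensional Nash inequality. Along [d ^+ i] the law stays close to its
   maximum [u m] as long as i^2 times the defect is small; taking about 2 / u m
   such points would exceed the total mass unless the defect is at least of
   order (u m)^3. *)
Lemma return_step m : q / 27 * u m ^+ 3 <= u m - u m.+1.
Proof.
have [u0|u0] := leP (u m) 0.
  have -> : u m = 0 by apply/eqP; rewrite eq_le u0 pow_ge0.
  have := u_nincr m; have -> : u m = 0 by apply/eqP; rewrite eq_le u0 pow_ge0.
  by rewrite expr0n mulr0.
have u1 : u m <= 1 by exact: pow_le1.
set Dl := u m - u m.+1.
have q0 : 0 < q by [].
have [I [I2 I3]] : exists I : nat, 2 / u m <= I%:R /\ I%:R <= 3 / u m.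
  have /Num.Theory.truncn_itv/andP[I1 I2] : 0 <= 2 / u m by rewrite divr_ge0 // ltW.
  exists (Num.truncn (2 / u m)).+1; split; first exact: ltW.
  rewrite -natr1; apply: le_trans (lerD I1 (_ : 1 <= (u m)^-1)) _.
    by rewrite invf_ge1.
  lra.
have le1 : \sum_(i < I) p (m + m) (d ^+ i)%g <= 1.
  rewrite -(expect_cst 1 (prob_convolve_pow (m + m) nu_prob)).
  under eq_bigr do rewrite -expect_point.
  rewrite -expect_sum; apply: ler_expect => [x|x _]; first exact: pow_ge0.
  under eq_bigr do rewrite eq_sym.
  have /(@sum_eq_le1 R _ _ x) : uniq [seq (d ^+ i)%g | i <- index_iota 0 I].
    by rewrite map_inj_uniq ?iota_uniq.
  by rewrite big_map big_mkord.
have E (i : 'I_I) : u m - I%:R ^+ 2 * (Dl / q) <= p (m + m) (d ^+ i)%g.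
  have Dd : D m d <= Dl / q by rewrite ler_pdivlMr // mulrC pow_defect_step.
  have := pow_defect_scale m i; have := D_ge0 m d.
  have : i%:R ^+ 2 <= I%:R ^+ 2 :> R.
    by rewrite lerXn2r ?nnegrE ?ler0n // ler_nat ltnW.
  have : 0 <= i%:R ^+ 2 :> R by exact: sqr_ge0.
  rewrite {2}/D; nra.
have {}le1 : I%:R * u m - I%:R ^+ 3 * (Dl / q) <= 1.
  apply: le_trans le1; apply: le_trans (ler_sum _ (fun i _ => E i)).
  rewrite sumr_const card_ord -mulr_natl; lra.
have Dq0 : 0 <= Dl / q by rewrite divr_ge0 ?u_nincr // ltW.
have I3' : I%:R ^+ 3 <= 27 / u m ^+ 3.
  have -> : 27 / u m ^+ 3 = (3 / u m) ^+ 3 by field; rewrite gt_eqF.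
  by rewrite lerXn2r ?nnegrE ?ler0n // divr_ge0 // ltW.
have I2' : 2 <= I%:R * u m by rewrite -ler_pdivrMr.
have {le1 I3' I2'} : 1 <= 27 / u m ^+ 3 * (Dl / q).
  by have := ler_wpM2r Dq0 I3'; lra.
rewrite mulf_div ler_pdivlMr ?mulr_gt0 ?exprn_gt0 // mul1r; lra.
Qed.

(** Discrete counterpart of u' <= - k u^3, which integrates to
   u^-2 >= 1 + 2 k t. *)
Lemma return_bound m : u m ^+ 2 * (1 + q * 2 / 27 * m%:R) <= 1.
Proof.
have q0 : 0 < q by [].
have q1 : q <= 1 by exact: pow_le1.
elim: m => [|m IH].
  by rewrite mulr0 addr0 mulr1 expr_le1 ?pow_ge0 // pow_le1.
have := return_step m; set k := q / 27; rewrite -/k in IH *.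
have := pow_ge0 (m.+1 + m.+1) 1%g; have := pow_ge0 (m + m) 1%g.
have := pow_le1 (m + m) 1%g.
rewrite -/(u m) -/(u m.+1) => a1 a0 b0 ab.
have -> : q * 2 / 27 = 2 * k by rewrite /k; lra.
have k0 : 0 <= k by rewrite divr_ge0 // ltW.
have k1 : k <= 1 by rewrite /k; lra.
have {}IH : u m ^+ 2 * (1 + 2 * k * m%:R) <= 1.
  by move: IH; rewrite /k; lra.
set a := u m in a1 a0 ab IH; set b := u m.+1 in b0 ab *; set z := k * a ^+ 2.
have z0 : 0 <= z by rewrite mulr_ge0 // sqr_ge0.
have z1 : z <= 1 by rewrite mulr_ile1 ?sqr_ge0 // expr_le1.
have {}ab : b <= a * (1 - z) by rewrite /z; lra.
have b2 : b ^+ 2 <= a ^+ 2 * (1 - z) ^+ 2.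
  by rewrite -exprMn lerXn2r ?nnegrE // mulr_ge0 // subr_ge0.
rewrite -[m.+1%:R]natr1; set M : R := m%:R in IH *.
have M0 : 0 <= M by rewrite ler0n.
have H : b ^+ 2 * (1 + 2 * k * (M + 1)) <=
   (1 - z) ^+ 2 * (a ^+ 2 * (1 + 2 * k * M) + 2 * z).
  apply: (le_trans (ler_wpM2r _ b2)); last by rewrite /z; lra.
  by have := mulr_ge0 k0 M0; lra.
apply: (le_trans H).
have {}H : (1 - z) ^+ 2 * (a ^+ 2 * (1 + 2 * k * M) + 2 * z) <=
   (1 - z) ^+ 2 * (1 + 2 * z).
  by rewrite ler_wpM2l ?sqr_ge0 // lerD2r.
apply: (le_trans H).
have -> : (1 - z) ^+ 2 * (1 + 2 * z) = 1 - z ^+ 2 * (3 - 2 * z) by ring.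
have := sqr_ge0 z; nra.
Qed.

(** The law after an odd number of steps is an average of laws at the preceding
   even time, which are largest at the identity. *)
Lemma pow_sup_bound :
  exists2 C : R, 0 < C & forall n z, p n z <= C / Num.sqrt n.+1%:R.
Proof.
have q0 : 0 < q by [].
set k := q * 2 / 27.
have k0 : 0 < k by rewrite divr_gt0 ?mulr_gt0.
pose c := Num.min 2^-1 (k / 2).
have c0 : 0 < c by rewrite lt_min invr_gt0 ltr0n divr_gt0.
have um m n : (n <= (m + m).+1)%N -> u m <= (Num.sqrt c)^-1 / Num.sqrt n.+1%:R.
  move=> nm; rewrite -invfM -sqrtrM ?(ltW c0) //.
  have s0 : 0 < c * n.+1%:R by rewrite mulr_gt0.
  rewrite -[leRHS]mul1r ler_pdivlMr ?sqrtr_gt0 //.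
  rewrite -(@ler_pXn2r _ 2) ?nnegrE ?mulr_ge0 ?pow_ge0 ?sqrtr_ge0 //.
  rewrite exprMn sqr_sqrtr ?(ltW s0) // expr1n.
  apply: le_trans (return_bound m); rewrite ler_wpM2l ?sqr_ge0 // -/k.
  have : n.+1%:R <= 2 * m%:R + 2 :> R.
    by rewrite -natrM -natrD ler_nat; lia.
  have c1 : c <= 2^-1 by rewrite ge_min lexx.
  have c2 : c <= k / 2 by rewrite ge_min lexx orbT.
  have : 0 <= m%:R :> R by rewrite ler0n.
  set N : R := n.+1%:R; set M : R := m%:R => M0 NM.
  apply: le_trans (ler_wpM2l (ltW c0) NM) _.
  by have := ler_wpM2r M0 c2; lra.
exists (Num.sqrt c)^-1 => [|n z]; first by rewrite invr_gt0 sqrtr_gt0.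
have [b [m [-> b1]]] : exists b m, n = ((m + m) + b)%N /\ (b <= 1)%N.
  exists (odd n : nat), (n./2); split; last by case: odd.
  by rewrite addnn addnC odd_double_half.
apply: le_trans (um m _ _); last by lia.
case: b b1 => [|[|//]] _; first by rewrite addn0 even_pow_le.
rewrite addn1 convolve_powS -[leRHS](expect_cst _ nu_prob).
by apply: ler_expect => [x|x _]; [case: nu_prob|exact: even_pow_le].
Qed.

End Direction.
End ReturnProbabilities.

(** * Paths and local times *)

Section Paths.
Context {R : realType} {G : groupType} (nu : {fsfun G -> R with 0}).
Implicit Types (F : seq G -> R) (w : seq G) (y z : G).

Fixpoint path_expect n F : R :=
  if n is n'.+1 then expect nu (fun s => path_expect n' (fun w => F (s :: w)))
  else F [::].

(** A path is the list of its steps, the latest one first, and sites are given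
   relative to the final position. Dropping the latest step [s] moves the final
   position back by [s], so the site [y] becomes [s * y]. *)
Fixpoint visits y w : nat :=
  (y == 1%g) + if w is s :: w' then visits (s * y)%g w' else 0.

(** Every step switches the lamp once where it starts and once where it ends. *)
Fixpoint switches y w : nat :=
  if w is s :: w' then
    switches (s * y)%g w' + ((s * y == 1)%g + (y == 1%g))
  else 0.

(** Each visit is preceded and followed by a switch, except that nothing precedes
   the initial visit and nothing follows the final one. *)
Lemma switches_le_visits y w : (switches y w <= 2 * visits y w <= switches y w + 2)%N.
Proof.
suff [e e1 ->] : exists2 e : nat, (e <= 1)%N &
  (2 * visits y w = switches y w + ((y == 1%g) + e))%N.
  by case: (y == 1%g) => /=; lia.
elim: w y => [|s w IH] y /=; first by exists (y == 1%g : nat); [case: eqP|lia].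
have [e e1 He] := IH (s * y)%g; exists e => //; lia.
Qed.

Lemma sum_switches_le (ys : seq G) w : uniq ys ->
  (\sum_(y <- ys) switches y w <= 2 * size w)%N.
Proof.
have count1 (zs : seq G) : uniq zs -> (\sum_(y <- zs) (y == 1%g) <= 1)%N.
  move=> /count_uniq_mem cu; rewrite (eq_bigr (fun y => if y == 1%g then 1%N else 0%N)).
    by rewrite -big_mkcond sum1_count cu leq_b1.
  by move=> y _; case: eqP.
elim: w ys => [|s w IH] ys uys; first by rewrite big1.
have us : uniq [seq (s * y)%g | y <- ys] by rewrite map_inj_uniq //; exact: mulgI.
have := IH _ us; have := count1 _ us; have := count1 _ uys.
by rewrite /= !big_map !big_split /=; lia.
Qed.

Section Linearity.

Lemma eq_path_expect n F F' : (forall w, size w = n -> F w = F' w) ->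
  path_expect n F = path_expect n F'.
Proof.
elim: n F F' => [|n IH] F F' FF' /=; first exact: FF'.
by apply: eq_expect => s; apply: IH => w wn; apply: FF'; rewrite /= wn.
Qed.

Lemma path_expectD n F F' :
  path_expect n (fun w => F w + F' w) = path_expect n F + path_expect n F'.
Proof.
elim: n F F' => [//|n IH] F F' /=.
by rewrite -expectD; apply: eq_expect => s; rewrite IH.
Qed.

Lemma path_expectZ n c F : path_expect n (fun w => c * F w) = c * path_expect n F.
Proof.
elim: n F => [//|n IH] F /=.
by rewrite -expectZ; apply: eq_expect => s; rewrite IH.
Qed.

Lemma path_expectB n F F' :
  path_expect n (fun w => F w - F' w) = path_expect n F - path_expect n F'.
Proof.
rewrite path_expectD -[in RHS]mulN1r -path_expectZ; congr (_ + _).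
by apply: eq_path_expect => w _; rewrite mulN1r.
Qed.

Lemma path_expect_sum n (I : Type) (r : seq I) (F : I -> seq G -> R) :
  path_expect n (fun w => \sum_(i <- r) F i w) = \sum_(i <- r) path_expect n (F i).
Proof.
elim: r => [|i r IH].
  under eq_path_expect do rewrite big_nil -(mul0r 0).
  by rewrite path_expectZ mul0r big_nil.
rewrite big_cons -IH -path_expectD.
by apply: eq_path_expect => w _; rewrite big_cons.
Qed.

End Linearity.

Hypothesis (nu_prob : prob_meas nu).

Lemma ler_path_expect n F F' : (forall w, size w = n -> F w <= F' w) ->
  path_expect n F <= path_expect n F'.
Proof.
elim: n F F' => [|n IH] F F' FF' /=; first exact: FF'.
apply: ler_expect => [x|s _]; first by case: nu_prob.
by apply: IH => w wn; apply: FF'; rewrite /= wn.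
Qed.

Lemma path_expect_cst n c : path_expect n (fun=> c) = c.
Proof.
by elim: n => [//|n IH] /=; under eq_expect do rewrite IH; rewrite expect_cst.
Qed.

Lemma path_markov n (a : R) F : 0 < a -> (forall w, 0 <= F w) ->
  path_expect n (fun w => (a < F w)%R%:R) <= path_expect n F / a.
Proof.
move=> a0 F0; rewrite mulrC -path_expectZ; apply: ler_path_expect => w _.
case: (ltP a (F w)) => /= [aF|_]; last by rewrite mulr_ge0 ?invr_ge0 // ltW.
by rewrite mulrC ler_pdivlMr // mul1r ltW.
Qed.

Hypothesis (nu_sym : symmetric_meas nu).
Local Notation p := (convolve_pow nu).

Lemma expect_step n y : expect nu (fun s => p n (s * y)%g) = p n.+1 y.
Proof.
by rewrite convolve_powS (expect_sym _ nu_sym); apply: eq_expect => s; rewrite ?invgK.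
Qed.

Lemma path_expect_visits n y :
  path_expect n (fun w => (visits y w)%:R) = \sum_(i < n.+1) p i y.
Proof.
elim: n y => [|n IH] y.
  by rewrite big_ord1 /= addn0 fsfun_fun in_fset1; case: eqP.
rewrite big_ord_recl /=.
under eq_expect => s.
  under eq_path_expect => w _ do rewrite natrD.
  by rewrite path_expectD path_expect_cst IH over.
rewrite expectD expect_cst // expect_sum; congr (_ + _).
  by rewrite fsfun_fun in_fset1; case: eqP.
by apply: eq_bigr => i _; rewrite expect_step.
Qed.

Section Direction.
Variable d : G.
Hypotheses (d_step : 0 < p 2 d) (d_free : injective (fun i : nat => d ^+ i)%g).

Lemma sum_inv_sqrt n :
  \sum_(i < n) (Num.sqrt i.+1%:R)^-1 <= 2 * Num.sqrt n%:R :> R.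
Proof.
elim: n => [|n IH]; first by rewrite big_ord0 sqrtr0 mulr0.
rewrite big_ord_recr /=; apply: le_trans (lerD IH (lexx _)) _.
set a := Num.sqrt n%:R; set b := Num.sqrt n.+1%:R.
have b0 : 0 < b by rewrite sqrtr_gt0.
have a0 : 0 <= a by exact: sqrtr_ge0.
have ab : b ^+ 2 = a ^+ 2 + 1 by rewrite !sqr_sqrtr ?ler0n // -natr1.
have le_ab : a <= b by rewrite ler_sqrt ?ler_nat.
rewrite -(ler_pM2r b0) mulrDl mulVf ?gt_eqF //; nra.
Qed.

Lemma path_visits_bound : exists2 C : R, 0 < C & forall n y,
  path_expect n (fun w => (visits y w)%:R) <= C * Num.sqrt n.+1%:R.
Proof.
have [C C0 pC] := pow_sup_bound nu_prob nu_sym d_step d_free.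
exists (2 * C) => [|n y]; first exact: mulr_gt0.
rewrite path_expect_visits.
apply: le_trans (ler_sum _ (fun (i : 'I_n.+1) _ => pC i y)) _.
by rewrite -mulr_sumr -mulrA mulrCA ler_pM2l // sum_inv_sqrt.
Qed.

Lemma path_switches_bound : exists2 C : R, 0 < C & forall n y,
  path_expect n (fun w => (switches y w)%:R) <= C * Num.sqrt n%:R.
Proof.
have [C C0 vC] := path_visits_bound.
exists (4 * C) => [|[|n] y]; first exact: mulr_gt0.
  by rewrite /= sqrtr0 mulr0.
have le1 : path_expect n.+1 (fun w => (switches y w)%:R) <=
           2 * path_expect n.+1 (fun w => (visits y w)%:R).
  rewrite -path_expectZ; apply: ler_path_expect => w _.
  by have /andP[+ _] := switches_le_visits y w; rewrite -natrM ler_nat.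
apply: (le_trans le1); have := vC n.+1 y.
have : Num.sqrt n.+2%:R <= 2 * Num.sqrt n.+1%:R :> R.
  have -> : 2 = Num.sqrt (2 ^+ 2) :> R by rewrite sqrtr_sqr ger0_norm.
  rewrite -sqrtrM ?sqr_ge0 // ler_sqrt ?mulr_ge0 ?ler0n //.
  by rewrite -natrX -natrM ler_nat; lia.
nra.
Qed.

(** The local time profile is flat along [d]: the variance of its increment is of
   the order of the local time, not of its square. Unrolling one step, a visit
   to [y] contributes its correlation with the later increments, which is a
   partial sum of the potential kernel and hence bounded. *)
Lemma path_visits_flat : exists2 C : R, 0 < C & forall n y,
  path_expect n (fun w => ((visits y w)%:R - (visits (y * d) w)%:R) ^+ 2)
    <= C * Num.sqrt n.+1%:R.
Proof.
have [C C0 vC] := path_visits_bound.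
pose K := 2 * (4 / p 2 d) + 1.
have K1 : 1 <= K by rewrite lerDr mulr_ge0 // divr_ge0 // ltW.
have d1 : d != 1%g.
  by apply/eqP => d1; have /d_free : (d ^+ 0 = d ^+ 1)%g by rewrite d1 !expg1n.
pose L n y := path_expect n (fun w => (visits y w)%:R).
have LS n y : L n.+1 y = (y == 1%g)%:R + expect nu (fun s => L n (s * y)%g).
  rewrite /L /=; under eq_expect => s.
    under eq_path_expect => w _ do rewrite natrD.
    by rewrite path_expectD path_expect_cst over.
  by rewrite expectD expect_cst.
suff H : forall n y, path_expect n (fun w => ((visits y w)%:R - (visits (y * d)%g w)%:R) ^+ 2)
    <= K * (L n y + L n (y * d)%g).
  exists (2 * K * C) => [|n y].
    by rewrite !mulr_gt0 // (lt_le_trans ltr01).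
  apply: le_trans (H n y) _.
  have := vC n y; have := vC n (y * d)%g; rewrite -/(L n _) -/(L n _).
  have := sqrtr_ge0 (n.+1%:R : R); nra.
pose a y : R := (y == 1%g)%:R - (y * d == 1)%g%:R.
have a2 y : a y ^+ 2 <= (y == 1%g)%:R + (y * d == 1)%g%:R.
  by rewrite /a; case: eqP => _; case: eqP => _; rewrite ?subrr ?sub0r ?subr0 ?expr0n ?sqrrN ?expr1n //=; lra.
have aL n y : a y * (expect nu (fun s => L n (s * y)%g) -
                     expect nu (fun s => L n (s * y * d)%g)) <=
              4 / p 2 d * ((y == 1%g)%:R + (y * d == 1)%g%:R).
  have Lp z : expect nu (fun s => L n (s * z)%g) = \sum_(i < n.+1) p i.+1 z.
    under eq_expect => s do rewrite /L path_expect_visits.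
    by rewrite expect_sum; apply: eq_bigr => i _; rewrite expect_step.
  have -> : expect nu (fun s => L n (s * y * d)%g) = \sum_(i < n.+1) p i.+1 (y * d)%g.
    by rewrite -Lp; apply: eq_expect => s; rewrite mulgA.
  rewrite Lp /a.
  have B : \sum_(i < n.+1) p i.+1 1%g - \sum_(i < n.+1) p i.+1 d <= 4 / p 2 d.
    rewrite -sumrB; apply: le_trans (sum_pow_defect nu_prob nu_sym d_step n.+2).
    rewrite [leRHS]big_ord_recl lerDr /= subr_ge0.
    by rewrite !fsfun_fun !in_fset1 eqxx (negPf d1).
  have [->|y1] := eqVneq y 1%g.
    by rewrite mul1g (negPf d1) subr0 mul1r addr0 mulr1.
  have [yd|yd] := eqVneq (y * d)%g 1%g; last by rewrite subrr mul0r addr0 mulr0.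
  have -> : y = d^-1%g by rewrite -[RHS]mul1g -yd mulgK.
  rewrite mulVg sub0r add0r mulr1 mulN1r opprB.
  have -> : \sum_(i < n.+1) p i.+1 d^-1%g = \sum_(i < n.+1) p i.+1 d.
    by apply: eq_bigr => i _; exact: symmetric_pow.
  exact: B.
elim => [|n IH] y.
  rewrite /L /= !addn0; apply: le_trans (a2 y) _.
  by rewrite ler_peMl // addr_ge0.
have -> : path_expect n.+1 (fun w => ((visits y w)%:R - (visits (y * d)%g w)%:R) ^+ 2)
  = expect nu (fun s => path_expect n (fun w => ((visits (s * y) w)%:R - (visits (s * y * d)%g w)%:R) ^+ 2))
   + 2 * (a y * (expect nu (fun s => L n (s * y)%g) -
                     expect nu (fun s => L n (s * y * d)%g))) + a y ^+ 2.
  rewrite -expectB mulrA -expectZ -expectD.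
  rewrite -[X in _ + X](expect_cst _ nu_prob) -expectD /=; apply: eq_expect => s.
  rewrite /L -path_expectB -path_expectZ -path_expectD.
  rewrite -[X in _ + X](path_expect_cst n) -path_expectD.
  by apply: eq_path_expect => w _; rewrite !natrD !mulgA /a; ring.
have le1 : expect nu (fun s => path_expect n (fun w =>
     ((visits (s * y) w)%:R - (visits (s * y * d)%g w)%:R) ^+ 2)) <=
   K * (expect nu (fun s => L n (s * y)%g) + expect nu (fun s => L n (s * y * d)%g)).
  rewrite -expectD -expectZ; apply: ler_expect => [x|s _]; first by case: nu_prob.
  exact: IH.
rewrite !LS.
have -> : expect nu (fun s => L n (s * (y * d))%g) = expect nu (fun s => L n (s * y * d)%g).
  by apply: eq_expect => s; rewrite mulgA.
have := aL n y; have := a2 y; rewrite /K in le1 *; lra.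
Qed.

End Direction.
End Paths.

(** * Switch-walk-switch walks on wreath products *)

Section WreathWalk.
Context {R : realType} {A B : groupType}.
Variables (nu : {fsfun A -> R with 0}) (muB : {fsfun B -> R with 0}).
Implicit Types (w : seq A) (h : wreath A B) (r : A -> B).

Definition sws_step (s : A) (b b' : B) : wreath A B :=
  (wr_delta b * wr_acting s * wr_delta b')%g.

(** Lamps in the coordinates of the walker, which are those of [switches]. *)
Definition rel_lamp h (y : A) : B := wr_lamp h (wr_base h * y)%g.

Definition rel_step s b b' r (y : A) : B :=
  (r (s * y) * (if s * y == 1 then b else 1) * (if y == 1 then b' else 1))%g.

Definition reset r (y : A) (c : B) (z : A) : B := if z == y then c else r z.

Lemma wr_deltaE (b : B) (x : A) :
  wr_lamp (wr_delta b) x = if x == 1%g then b else 1%g.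
Proof. by rewrite fsfun_fun in_fset1. Qed.

Lemma wr_mulgE (u v : wreath A B) x :
  wr_lamp (u * v)%g x = (wr_lamp u x * wr_lamp v ((wr_base u)^-1 * x))%g.
Proof. exact: wr_mulE. Qed.

Lemma wr_mulg_base (u v : wreath A B) :
  wr_base (u * v)%g = (wr_base u * wr_base v)%g.
Proof. by []. Qed.

Lemma rel_lamp1 : rel_lamp 1%g = fun=> 1%g.
Proof. by apply/funext => y; exact: fsfun0E. Qed.

Lemma rel_lamp_step h s b b' :
  rel_lamp (h * sws_step s b b')%g = rel_step s b b' (rel_lamp h).
Proof.
have base_step : wr_base (sws_step s b b') = s.
  by rewrite /sws_step !wr_mulg_base /= mul1g mulg1.
apply/funext => y; rewrite /rel_lamp /rel_step wr_mulg_base base_step.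
rewrite wr_mulgE -!mulgA mulKg /sws_step !wr_mulgE !wr_deltaE.
by rewrite wr_mulg_base /= fsfun0E mulg1 mul1g mulKg.
Qed.

Lemma expect_sws (F : wreath A B -> R) :
  expect (switch_walk_switch nu muB) F =
  expect muB (fun b => expect nu (fun s => expect muB (fun b' =>
    F (sws_step s b b')))).
Proof.
rewrite !expect_convolve expect_push; apply: eq_expect => b.
by rewrite expect_push; apply: eq_expect => s; rewrite expect_push.
Qed.

(** Expectation over the base path together with the group element it leads to.
   Both grow by the latest step, which keeps [rel_lamp] and [switches] in
   phase. *)
Fixpoint joint n (F : seq A -> wreath A B -> R) : R :=
  if n is n'.+1 then
    joint n' (fun w h => expect muB (fun b => expect nu (fun s =>
      expect muB (fun b' => F (s :: w) (h * sws_step s b b')%g))))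
  else F [::] 1%g.

Lemma eq_joint n F F' : (forall w h, F w h = F' w h) -> joint n F = joint n F'.
Proof. by move=> FF'; congr joint; apply/funext => w; apply/funext. Qed.

Lemma jointD n F F' :
  joint n (fun w h => F w h + F' w h) = joint n F + joint n F'.
Proof.
elim: n F F' => [//|n IH] F F' /=; rewrite -IH; apply: eq_joint => w h.
rewrite -expectD; apply: eq_expect => b; rewrite -expectD; apply: eq_expect => s.
by rewrite -expectD.
Qed.

Lemma jointZ n c F : joint n (fun w h => c * F w h) = c * joint n F.
Proof.
elim: n F => [//|n IH] F /=; rewrite -IH; apply: eq_joint => w h.
rewrite -expectZ; apply: eq_expect => b; rewrite -expectZ; apply: eq_expect => s.
by rewrite -expectZ.
Qed.

Lemma joint_sum n (I : Type) (l : seq I) F :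
  joint n (fun w h => \sum_(i <- l) F i w h) = \sum_(i <- l) joint n (F i).
Proof.
elim: l => [|i l IH].
  under eq_joint do rewrite big_nil -(mul0r 0).
  by rewrite jointZ mul0r big_nil.
rewrite big_cons -IH -jointD.
by apply: eq_joint => w h; rewrite big_cons.
Qed.

Lemma exchange_joint {T : choiceType} n (mu : {fsfun T -> R with 0}) F :
  joint n (fun w h => expect mu (fun x => F x w h)) =
  expect mu (fun x => joint n (F x)).
Proof.
rewrite joint_sum; apply: eq_bigr => x _; exact: jointZ.
Qed.

Lemma jointS n F : joint n.+1 F = expect nu (fun s => joint n (fun w h =>
  expect muB (fun b => expect muB (fun b' => F (s :: w) (h * sws_step s b b')%g)))).
Proof.
by rewrite -exchange_joint; apply: (@eq_joint n) => w h; rewrite exchange_expect.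
Qed.

Lemma expect_joint n (F : wreath A B -> R) :
  expect (convolve_pow (switch_walk_switch nu muB) n) F = joint n (fun=> F).
Proof.
elim: n F => [|n IH] F; first exact: expect_dirac1.
by rewrite expect_powSr IH /=; apply: eq_joint => w h; rewrite expect_sws.
Qed.

Hypotheses (nu_prob : prob_meas nu) (muB_prob : prob_meas muB).

Lemma joint_path n (F : seq A -> R) :
  joint n (fun w _ => F w) = path_expect nu n F.
Proof.
elim: n F => [//|n IH] F.
rewrite jointS /=; apply: eq_expect => s; rewrite -IH; apply: eq_joint => w h.
by rewrite !expect_cst.
Qed.

(** Comparison needs to hold only on reachable pairs, which are described by an
   invariant of the steps. *)
Lemma ler_joint (I : seq A -> wreath A B -> Prop) n F F' :
  I [::] 1%g ->
  (forall s b b' w h, s \in finsupp nu -> I w h ->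
     I (s :: w) (h * sws_step s b b')%g) ->
  (forall w h, size w = n -> I w h -> F w h <= F' w h) ->
  joint n F <= joint n F'.
Proof.
move=> I0 IS; elim: n F F' => [|n IH] F F' FF' /=; first exact: FF'.
apply: IH => w h wn Iwh.
have [[m0 _] [n0 _]] := (muB_prob, nu_prob).
apply: ler_expect => // b _; apply: ler_expect => // s sn.
by apply: ler_expect => // b' _; apply: FF'; [rewrite /= wn|exact: IS].
Qed.

Lemma ler_joint_simple n F F' : (forall w h, F w h <= F' w h) ->
  joint n F <= joint n F'.
Proof. by move=> FF'; apply: (@ler_joint (fun _ _ => True)). Qed.

(** A step multiplies the lamp at a site by zero, one or two fresh lamp steps
   according to which ends of the step lie there, so a run of length [t] at this
   site becomes a run whose length is increased by the number of switches. *)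
Lemma reset_step r (Phi : (A -> B) -> R) s y t :
  expect (convolve_pow muB t) (fun c => expect muB (fun b => expect muB (fun b' =>
    Phi (rel_step s b b' (reset r (s * y)%g c))))) =
  expect muB (fun b => expect muB (fun b' =>
    expect (convolve_pow muB (t + ((s * y == 1)%g + (y == 1%g))))
      (fun c => Phi (reset (rel_step s b b' r) y c)))).
Proof.
pose Psi b b' c := Phi (reset (rel_step s b b' r) y c).
have E b b' c : Phi (rel_step s b b' (reset r (s * y)%g c)) =
   Psi b b' (c * (if s * y == 1 then b else 1) * (if y == 1 then b' else 1))%g.
  congr Phi; apply/funext => z; rewrite /rel_step /reset (inj_eq (mulgI s)).
  by case: eqP => // ->.
have Psi1 b b' c : (s * y == 1)%g -> Psi b b' c = Psi 1%g b' c.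
  move=> /eqP sy; congr Phi; apply/funext => z; rewrite /reset.
  case: eqP => // zy; rewrite /rel_step; case: eqP => // sz.
  by case: zy; apply: (mulgI s); rewrite sz.
have Psi2 b b' c : (y == 1)%g -> Psi b b' c = Psi b 1%g c.
  move=> /eqP y1; congr Phi; apply/funext => z; rewrite /reset.
  case: eqP => // zy; rewrite /rel_step; have [z1|//] := eqVneq z 1%g.
  by case: zy; rewrite z1 y1.
transitivity (expect muB (fun b => expect muB (fun b' =>
  expect (convolve_pow muB t) (fun c =>
   Psi b b' (c * (if s * y == 1 then b else 1) * (if y == 1 then b' else 1))%g)))).
  rewrite exchange_expect; apply: eq_expect => b.
  by rewrite exchange_expect; do 2!apply: eq_expect => ?; exact: E.
have powS t' (f : B -> R) : expect (convolve_pow muB t'.+1) f =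
    expect muB (fun b => expect (convolve_pow muB t') (fun c => f (c * b)%g)).
  by rewrite expect_powSr exchange_expect.
rewrite -/(Psi _ _ _).
have [sy|sy] := boolP (s * y == 1)%g; have [y1|y1] := boolP (y == 1)%g => /=.
- rewrite addn2; transitivity (expect (convolve_pow muB t.+2) (Psi 1%g 1%g)).
    rewrite powS [LHS]exchange_expect; apply: eq_expect => b; rewrite powS.
    apply: eq_expect => b'; apply: eq_expect => c.
    by rewrite (Psi1 _ _ _ sy) (Psi2 _ _ _ y1).
  rewrite -[LHS](expect_cst _ muB_prob); apply: eq_expect => b.
  rewrite -[LHS](expect_cst _ muB_prob); apply: eq_expect => b'.
  by apply: eq_expect => c; rewrite -/(Psi b b' c) (Psi1 _ _ _ sy) (Psi2 _ _ _ y1).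
- rewrite addn0 addn1 [LHS]exchange_expect [RHS]exchange_expect; apply: eq_expect => b'.
  rewrite -[LHS](expect_cst _ muB_prob); apply: eq_expect => b0.
  rewrite powS; apply: eq_expect => b; apply: eq_expect => c.
  by rewrite -/(Psi b0 b' _) !(Psi1 _ _ _ sy) mulg1.
- rewrite add0n addn1; apply: eq_expect => b.
  rewrite -[LHS](expect_cst _ muB_prob); apply: eq_expect => b0.
  rewrite powS; apply: eq_expect => b'; apply: eq_expect => c.
  by rewrite -/(Psi b b0 _) !(Psi2 _ _ _ y1) mulg1.
- rewrite !addn0; do 3!apply: eq_expect => ?.
  by rewrite !mulg1.
Qed.

(** Given the base path the lamps are independent, each being a run of the lamp
   walk as long as its number of switches. Resampling one lamp at a time
   expresses this without product measures; the site may depend on the path. *)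
Lemma joint_reset n (Y : seq A -> A) (F : seq A -> (A -> B) -> R) :
  joint n (fun w h => F w (rel_lamp h)) =
  joint n (fun w h => expect (convolve_pow muB (switches (Y w) w))
                        (fun c => F w (reset (rel_lamp h) (Y w) c))).
Proof.
elim: n Y F => [|n IH] Y F.
  rewrite /= expect_dirac1 rel_lamp1; congr F.
  by apply/funext => z; rewrite /reset; case: eqP.
rewrite !jointS; apply: eq_expect => s.
transitivity (joint n (fun w h => expect muB (fun b => expect muB (fun b' =>
  F (s :: w) (rel_step s b b' (rel_lamp h)))))).
  by apply: eq_joint => w h; do 2!apply: eq_expect => ?; rewrite rel_lamp_step.
rewrite (IH (fun w => s * Y (s :: w))%g (fun w r => expect muB (fun b =>
  expect muB (fun b' => F (s :: w) (rel_step s b b' r))))).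
apply: eq_joint => w h; rewrite reset_step.
by do 2!apply: eq_expect => ?; rewrite rel_lamp_step.
Qed.

Lemma joint_lamp n (Y : seq A -> A) (F : seq A -> B -> R) :
  joint n (fun w h => F w (rel_lamp h (Y w))) =
  path_expect nu n (fun w => expect (convolve_pow muB (switches (Y w) w)) (F w)).
Proof.
rewrite (joint_reset n Y (fun w r => F w (r (Y w)))) -joint_path.
by apply: eq_joint => w h; apply: eq_expect => c; rewrite /reset eqxx.
Qed.

End WreathWalk.

(** * Tails of random walks on the integers *)

Section IntegerWalk.
Context {R : realType}.

Definition zreal (v : Zgroup) : R := (v : int)%:~R.

Lemma zrealM x y : zreal (x * y)%g = zreal x + zreal y.
Proof. exact: intrD. Qed.

Lemma zrealV x : zreal x^-1%g = - zreal x.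
Proof. exact: intrN. Qed.

Lemma zreal1 : zreal 1%g = 0.
Proof. by []. Qed.

Lemma zreal_inj : injective zreal.
Proof. exact: intr_inj. Qed.

Lemma symmetric_mean (nu : {fsfun Zgroup -> R with 0}) :
  symmetric_meas nu -> expect nu zreal = 0.
Proof.
move=> nu_sym; have := expect_sym zreal nu_sym.
under [X in _ = X -> _]eq_expect do rewrite zrealV.
by rewrite expectN => H; lra.
Qed.

Lemma expg_free (s : Zgroup) : s != 1%g -> injective (fun i : nat => s ^+ i)%g.
Proof.
move=> s1 i j /(congr1 zreal).
have E k : zreal (s ^+ k)%g = k%:R * zreal s.
  elim: k => [|k IH]; first by rewrite expg0 zreal1 mul0r.
  by rewrite expgS zrealM IH -natr1; ring.
rewrite !E => /mulIf H; apply/eqP; rewrite -(eqr_nat R); apply/eqP/H.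
by apply: contra s1 => /eqP s0; apply/eqP/zreal_inj.
Qed.

Variable nu : {fsfun Zgroup -> R with 0}.
Hypothesis nu_step : nondegenerate_step nu.

Let nu_prob : prob_meas nu. Proof. by case: nu_step. Qed.
Let nu_sym : symmetric_meas nu. Proof. by case: nu_step. Qed.

(** A symmetric walk may be periodic, so neighbouring sites are compared only
   along a direction that two steps can realize. *)
Lemma step_direction : exists d : Zgroup, [/\ d != 1%g, 0 < convolve_pow nu 2 d
  & injective (fun i : nat => d ^+ i)%g].
Proof.
have [s sn s1] : exists2 s, s \in finsupp nu & s != 1%g.
  apply: contrapT => H; case: nu_step => _ _ /(_ (1%:Z : Zgroup)) [w [ws]].
  suff -> : (\prod_(x <- w) x)%g = 1%g by [].
  rewrite big_seq; apply: big1 => x /(allP ws) xs.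
  have {}xs : x \in finsupp nu.
    case/orP: xs => // xs; rewrite -[x]invgK mem_finsupp nu_sym -mem_finsupp //.
  by apply/eqP; apply: contrapT => /negP x1; apply: H; exists x.
have d1 : (s * s)%g != 1%g.
  apply/eqP => /(congr1 zreal); rewrite zrealM zreal1 => ss.
  by move/eqP: s1; apply; apply: zreal_inj; rewrite zreal1; lra.
exists (s * s)%g; split => //; last exact: expg_free.
have s0 : 0 < nu s.
  rewrite lt_neqAle eq_sym -mem_finsupp sn /=; by case: nu_prob.
rewrite convolve_powS; apply: (@lt_le_trans _ _ (nu s * nu s)); first exact: mulr_gt0.
rewrite /expect (big_fsetD1 s) //= mulKg convolve_pow1 lerDl.
apply: sumr_ge0 => x _; rewrite mulr_ge0 ?(pow_ge0 nu_prob) //; by case: nu_prob.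
Qed.

Lemma step_bound : exists2 M : nat, (0 < M)%N &
  forall s, s \in finsupp nu -> `|zreal s| <= M%:R.
Proof.
exists (\max_(s <- finsupp nu) `|s : int|%N).+1 => // s sn.
rewrite /zreal -intr_norm -abszE -[X in _ <= X]/((_.+1)%:R) ler_nat.
exact/leqW/leq_bigmax_seq.
Qed.

Definition tail t (z : R) : R :=
  expect (convolve_pow nu t) (fun v => (z <= zreal v)%R%:R).

Let pt_prob t : prob_meas (convolve_pow nu t) := prob_convolve_pow t nu_prob.
Let pt_ge0 t x : 0 <= convolve_pow nu t x := pow_ge0 nu_prob t x.

Lemma tail_ge0 t z : 0 <= tail t z.
Proof. exact: expect_ge0. Qed.

Lemma tail_nincr t y z : y <= z -> tail t z <= tail t y.
Proof.
move=> yz; apply: ler_expect => // v _.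
by case: (leP z) => // zv; rewrite (le_trans yz zv).
Qed.

Lemma tailS t z : tail t.+1 z = expect nu (fun s => tail t (z - zreal s)).
Proof.
rewrite /tail expect_powS; apply: eq_expect => s; apply: eq_expect => v.
by rewrite zrealM lerBlDl.
Qed.

(** One of the two opposite steps does not decrease the position. *)
Lemma tail_double t z : tail t z <= 2 * tail t.+1 z.
Proof.
have -> : 2 * tail t.+1 z =
    expect nu (fun s => tail t (z - zreal s) + tail t (z + zreal s)).
  rewrite expectD -!tailS mulr_natl mulr2n; congr (_ + _).
  by rewrite tailS (expect_sym _ nu_sym); apply: eq_expect => s; rewrite zrealV opprK.
rewrite -[leLHS](expect_cst _ nu_prob); apply: ler_expect => [x|s _].
  by case: nu_prob.
have [s0|s0] := leP 0 (zreal s).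
  by rewrite (le_trans (@tail_nincr t (z - zreal s) z _)) ?lerDl ?tail_ge0 // gerBl.
by rewrite (le_trans (@tail_nincr t (z + zreal s) z _)) ?lerDr ?tail_ge0 // gerDl ltW.
Qed.

Lemma tail0_ge t : 2^-1 <= tail t 0.
Proof.
have : 1 <= tail t 0 + tail t 0.
  rewrite {2}/tail (expect_sym _ (symmetric_pow t nu_sym)) -expectD.
  rewrite -[leLHS](expect_cst _ (pt_prob t)); apply: ler_expect => // v _.
  by rewrite zrealV oppr_ge0; case: (leP 0 (zreal v)) => [_|/ltW ->];
     rewrite ?lerDl ?lerDr.
lra.
Qed.

Lemma tailD t u y z : tail t y * tail u z <= tail (t + u) (y + z).
Proof.
rewrite /tail expect_powD -expectZr; apply: ler_expect => // v _.
rewrite -expectZ; apply: ler_expect => // x _; rewrite zrealM -natrM ler_nat mulnb.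
by case: andP => // -[yv zx]; rewrite lerD.
Qed.

Lemma tail_mul N t z : tail t z ^+ N <= tail (N * t) (N%:R * z).
Proof.
elim: N => [|N IH].
  by rewrite mul0n mul0r expr0 /tail expect_dirac1 zreal1 lexx.
rewrite mulSn -natr1 mulrDl mul1r addrC exprS; apply: le_trans (tailD _ _ _ _).
by rewrite ler_wpM2l ?tail_ge0.
Qed.

Lemma expect_sqr t : expect (convolve_pow nu t) (fun v => zreal v ^+ 2) =
  t%:R * expect nu (fun s => zreal s ^+ 2).
Proof.
have mean0 := symmetric_mean nu_sym.
elim: t => [|t IH]; first by rewrite expect_dirac1 zreal1 expr2 !mul0r.
rewrite expect_powSr.
under eq_expect => y.
  under eq_expect => x do rewrite zrealM sqrrD -mulrnAl.
  rewrite !expectD expect_cst // expectZ mean0 mulr0 addr0.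
  over.
by rewrite expectD IH expect_cst // -natr1 mulrDl mul1r.
Qed.

(** The steps are exchangeable, so each contributes equally to [zreal v]. *)
Lemma stein t (f : Zgroup -> R) :
  expect (convolve_pow nu t.+1) (fun v => zreal v * f v) =
  t.+1%:R * expect nu (fun s => zreal s *
    expect (convolve_pow nu t) (fun v => f (s * v)%g)).
Proof.
elim: t f => [|t IH] f.
  rewrite expect_pow1 mul1r; apply: eq_expect => s.
  by rewrite expect_dirac1 mulg1.
rewrite expect_powS.
transitivity (expect nu (fun s => zreal s *
    expect (convolve_pow nu t.+1) (fun v => f (s * v)%g)) +
  expect nu (fun s => expect (convolve_pow nu t.+1) (fun v => zreal v * f (s * v)%g))).
  rewrite -expectD; apply: eq_expect => s; rewrite -expectZ -expectD.
  by apply: eq_expect => v; rewrite zrealM mulrDl.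
rewrite -[in RHS]natr1 mulrDl mul1r addrC; congr (_ + _).
under eq_expect => s do rewrite (IH (fun v => f (s * v)%g)).
rewrite expectZ exchange_expect; congr (_ * _); apply: eq_expect => x.
rewrite expectZ expect_powS; congr (_ * _); apply: eq_expect => s.
apply: eq_expect => v; congr f; rewrite !mulgA; congr (_ * _)%g; exact: (@addrC int).
Qed.

Section Hazard.
Variable M : nat.
Hypothesis M_bound : forall s, s \in finsupp nu -> `|zreal s| <= M%:R.

Lemma expect_sqr_le t : expect (convolve_pow nu t) (fun v => zreal v ^+ 2) <=
  M%:R ^+ 2 * t%:R.
Proof.
rewrite expect_sqr mulrC ler_wpM2r // -[leRHS](expect_cst _ nu_prob).
apply: ler_expect => [x|s sn]; first by case: nu_prob.
by rewrite -real_normK ?num_real // lerXn2r ?nnegrE ?M_bound.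
Qed.

(** On the tail, [z] is at most [zreal v]; by the Stein identity and symmetry
   only those positions count for which the sign of the last step matters. *)
Lemma mills t z : 0 < z ->
  z * tail t.+1 z <= t.+1%:R * (M%:R / 2) * (tail t (z - M%:R) - tail t (z + M%:R)).
Proof.
move=> z0.
have le1 : z * tail t.+1 z <=
  expect (convolve_pow nu t.+1) (fun v => zreal v * (z <= zreal v)%R%:R).
  rewrite -expectZ; apply: ler_expect => // v _.
  by case: (leP z) => zv /=; rewrite !(mulr1, mulr0).
apply: (le_trans le1); rewrite stein -mulrA ler_pM2l ?ltr0n //.
pose g s := expect (convolve_pow nu t) (fun v => (z <= zreal (s * v)%g)%R%:R) : R.
rewrite -[leLHS]/(expect nu (fun s => zreal s * g s)).
have -> : expect nu (fun s => zreal s * g s) =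
   expect nu (fun s => 2^-1 * (zreal s * (g s - g s^-1%g))).
  under [RHS]eq_expect do rewrite mulrBr.
  rewrite expectZ expectB.
  rewrite [X in _ - X](expect_sym _ nu_sym).
  under [X in _ - X]eq_expect do rewrite zrealV invgK mulNr.
  rewrite expectN; lra.
rewrite -[leRHS](expect_cst _ nu_prob); apply: ler_expect => [x|s sn].
  by case: nu_prob.
suff : zreal s * (g s - g s^-1%g) <= M%:R * (tail t (z - M%:R) - tail t (z + M%:R)).
  lra.
rewrite /g /tail -!expectB -!expectZ; apply: ler_expect => // v _.
rewrite !zrealM zrealV; have /ler_normlP [] := M_bound sn.
case: (leP z (zreal s + zreal v)) => /=; case: (leP z (- zreal s + zreal v)) => /=;
case: (leP (z - M%:R) (zreal v)) => /=; case: (leP (z + M%:R) (zreal v)) => /=;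
by move=> *; lra.
Qed.

Lemma sum_lag (a : nat -> R) L n : (forall i, 0 <= a i) ->
  {homo a : i j / (i <= j)%N >-> j <= i} ->
  \sum_(i < n) (a i - a (i + L)%N) <= L%:R * a 0%N.
Proof.
move=> a0 ai; elim: L => [|L IH].
  by rewrite mul0r big1 // => i _; rewrite addn0 subrr.
rewrite -natr1 mulrDl mul1r.
have -> : \sum_(i < n) (a i - a (i + L.+1)%N) =
  \sum_(i < n) (a i - a (i + L)%N) + \sum_(i < n) (a (i + L)%N - a (i.+1 + L)%N).
  by rewrite -big_split; apply: eq_bigr => i _ /=; rewrite addSnnS; ring.
apply: lerD => //; have -> : \sum_(i < n) (a (i + L)%N - a (i.+1 + L)%N) = a L - a (n + L)%N.
  elim: n {IH} => [|n IH]; first by rewrite big_ord0 subrr.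
  by rewrite big_ord_recr IH /=; ring.
have := ai 0%N L (leq0n _); have := a0 (n + L)%N; lra.
Qed.

(** Over a stretch of length k the tail loses a large factor as soon as x k is
   large compared to the time: at each of its points the tail is dominated by a
   local mass, and the local masses telescope along the stretch. This is the
   Gaussian hazard rate, without a local limit theorem. *)
Lemma hazard t (x : R) k : 0 < x -> (2 * M <= k)%N -> (0 < k)%N ->
  tail t (x + k%:R) * (x * k%:R) <= 4 * M%:R ^+ 2 * t%:R * tail t (x + 1).
Proof.
move=> x0 Mk k0; case: t => [|t].
  rewrite /tail !expect_dirac1 zreal1.
  have -> : (x + k%:R <= 0) = false by rewrite leNgt ltr_wpDr ?ler0n.
  by rewrite mul0r !mulr_ge0.
have [n nk] : exists n, k = (n + M)%N by exists (k - M)%N; lia.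
have n0 : (k%:R <= 2 * n%:R :> R) by rewrite -natrM ler_nat; lia.
have sumle : n%:R * (x * tail t.+1 (x + k%:R)) <=
   t.+1%:R * (M%:R / 2) * ((2 * M)%:R * tail t (x + 1)).
  pose a i := tail t (x + 1 + i%:R).
  have a0 : a 0%N = tail t (x + 1) by rewrite /a addr0.
  rewrite -a0.
  have := @sum_lag a (2 * M) n (fun i => tail_ge0 _ _).
  have ai : {homo a : i j / (i <= j)%N >-> j <= i}.
    by move=> i j ij; apply: tail_nincr; rewrite lerD2l ler_nat.
  move=> /(_ ai) S; apply: le_trans (ler_wpM2l _ S); last first.
    by rewrite mulr_ge0 // divr_ge0.
  have -> : n%:R * (x * tail t.+1 (x + k%:R)) =
      \sum_(i < n) x * tail t.+1 (x + k%:R).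
    by rewrite sumr_const card_ord mulr_natl.
  rewrite [leRHS]mulr_sumr; apply: ler_sum => i _.
  pose z := x + (i.+1 + M)%:R.
  have xz : x <= z by rewrite lerDl.
  have -> : a i = tail t (z - M%:R).
    by rewrite /a /z natrD -[i.+1%:R]natr1; congr (tail t _); ring.
  have -> : a (i + 2 * M)%N = tail t (z + M%:R).
    by rewrite /a /z !natrD -[i.+1%:R]natr1; congr (tail t _); ring.
  apply: le_trans (mills t (lt_le_trans x0 xz)).
  apply: ler_pM => //; [exact: ltW|exact: tail_ge0|].
  apply: tail_nincr; rewrite lerD2l ler_nat nk.
  by rewrite leq_add2r.
have := tail_double t (x + 1); rewrite natrM in sumle.
have := tail_ge0 t.+1 (x + k%:R) => T0 Td.
have xT : 0 <= x * tail t.+1 (x + k%:R) by rewrite mulr_ge0 // ltW.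
have := ler_wpM2r xT n0.
have tM : 0 <= t.+1%:R * M%:R ^+ 2 :> R by rewrite mulr_ge0 ?sqr_ge0.
have := ler_wpM2l tM Td; lra.
Qed.

Lemma tail_chebyshev t (y : R) : 0 < y ->
  expect (convolve_pow nu t) (fun v => (y <= `|zreal v|)%R%:R) <= M%:R ^+ 2 * t%:R / y ^+ 2.
Proof.
move=> y0; rewrite ler_pdivlMr ?exprn_gt0 //; apply: le_trans (expect_sqr_le t).
rewrite -expectZr; apply: ler_expect => // v _.
case: (leP y) => yv; last by rewrite mul0r sqr_ge0.
by rewrite mul1r -[leRHS]real_normK ?num_real // lerXn2r ?nnegrE ?(ltW y0).
Qed.

End Hazard.

(** No point has mass above C / sqrt t, so an interval much shorter than sqrt t
   has mass at most one half; symmetry does the rest. *)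
Lemma tail_anticoncentration : exists a : R, exists t1 : nat, 0 < a /\
  forall t, (t1 <= t)%N -> 4^-1 <= tail t (a * Num.sqrt t%:R).
Proof.
have [d [d1 dp df]] := step_direction.
have [C C0 pC] := pow_sup_bound nu_prob nu_sym dp df.
exists (8 * C)^-1, (Num.truncn (16 * C ^+ 2)).+1; split.
  by rewrite invr_gt0 mulr_gt0.
move=> t t1; set y := _ * Num.sqrt _.
have Ct : 4 * C <= Num.sqrt t.+1%:R.
  rewrite -(@ler_pXn2r _ 2) ?nnegrE ?sqrtr_ge0 ?mulr_ge0 ?(ltW C0) // sqr_sqrtr ?ler0n //.
  have /Num.Theory.truncn_itv/andP[_ I2] : 0 <= 16 * C ^+ 2 by rewrite mulr_ge0 // sqr_ge0.
  have : (Num.truncn (16 * C ^+ 2)).+1%:R <= t.+1%:R :> R by rewrite ler_nat leqW.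
  lra.
have y0 : 0 <= y by rewrite mulr_ge0 ?sqrtr_ge0 // invr_ge0 mulr_ge0 // ltW.
have /Num.Theory.truncn_itv/andP[n1 n2] := y0.
set n := Num.truncn y in n1 n2.
have small : expect (convolve_pow nu t) (fun v => (`|zreal v| < y)%R%:R) <= 2^-1.
  have le1 : expect (convolve_pow nu t) (fun v => (`|zreal v| < y)%R%:R) <=
     expect (convolve_pow nu t) (fun v => \sum_(i < (2 * n).+1)
        (v == (i%:Z - n%:Z)%R)%:R).
    apply: ler_expect => // v _; case: (ltP `|zreal v|) => [vy|_]; last first.
      by apply: sumr_ge0.
    have vn : (`|(v : int)| <= n%:Z)%R.
      have := lt_trans vy n2; rewrite /zreal -intr_norm -[n.+1%:R]/(n.+1%:Z%:~R).
      by rewrite ltr_int; lia.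
    have iP : (absz ((v : int) + n%:Z)%R < (2 * n).+1)%N by lia.
    rewrite (bigD1 (Ordinal iP)) //=.
    have -> : (v == ((absz ((v : int) + n%:Z)%R)%:Z - n%:Z)%R) by apply/eqP; lia.
    by rewrite lerDl sumr_ge0.
  apply: (le_trans le1); rewrite expect_sum.
  under eq_bigr do rewrite expect_point.
  apply: le_trans (ler_sum _ (fun i _ => pC t _)) _.
  rewrite sumr_const card_ord -[leLHS]mulr_natl.
  have s0 : 0 < Num.sqrt t.+1%:R :> R by rewrite sqrtr_gt0.
  rewrite mulrA ler_pdivrMr // -[(2 * n).+1%:R]natr1 [(2 * n)%:R]natrM.
  have st : Num.sqrt t%:R <= Num.sqrt t.+1%:R :> R by rewrite ler_sqrt ?ler_nat.
  have yC : y * C = Num.sqrt t%:R / 8 by rewrite /y; field; rewrite gt_eqF.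
  have := ler_wpM2r (ltW C0) n1; lra.
have : 1 <= expect (convolve_pow nu t) (fun v => (`|zreal v| < y)%R%:R) +
   (tail t y + tail t y).
  have tV : tail t y = expect (convolve_pow nu t) (fun v => (y <= zreal v^-1%g)%R%:R).
    exact: expect_sym (symmetric_pow t nu_sym).
  rewrite {2}tV -!expectD.
  rewrite -[leLHS](expect_cst _ (pt_prob t)); apply: ler_expect => // v _.
  rewrite zrealV; case: (ltP `|zreal v|) => /= [_|]; first by rewrite lerDl addr_ge0.
  rewrite ler_normr add0r => /orP[->|->]; by rewrite ?lerDl ?lerDr.
lra.
Qed.

(** N independent blocks that each advance by a sqrt u reach N a sqrt u, which is
   any multiple of sqrt (N u) once N is large. *)
Lemma tail_lower (A : R) : 0 <= A -> exists p : R, exists t0 : nat, 0 < p /\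
  forall t, (t0 <= t)%N -> p <= tail t (A * Num.sqrt t%:R).
Proof.
move=> A0; have [a [t1 [a0 ta]]] := tail_anticoncentration.
have q0 : 0 <= 2 * A ^+ 2 / a ^+ 2 by rewrite divr_ge0 ?sqr_ge0 // mulr_ge0 ?sqr_ge0.
have /Num.Theory.truncn_itv/andP[_ N2] := q0.
set N := (Num.truncn _).+1 in N2.
have a20 : 0 < a ^+ 2 by exact: exprn_gt0.
have {}N2 : 2 * A ^+ 2 <= N%:R * a ^+ 2 by rewrite -ler_pdivrMr // ltW.
exists (4^-1 ^+ N / 2), (N * t1.+1)%N; split; first by rewrite divr_gt0 ?exprn_gt0.
move=> t; have N0 : (0 < N)%N by [].
set u := (t %/ N)%N; set r := (t %% N)%N.
have tE : t = (N * u + r)%N by rewrite /u /r; lia.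
move=> tN; have ut : (t1.+1 <= u)%N by rewrite leq_divRL // mulnC.
have rN : (r < N)%N by rewrite ltn_mod.
have AN : A * Num.sqrt t%:R <= N%:R * (a * Num.sqrt u%:R).
  rewrite -(@ler_pXn2r _ 2) ?nnegrE ?mulr_ge0 ?sqrtr_ge0 ?(ltW a0) ?ler0n //.
  rewrite !exprMn !sqr_sqrtr ?ler0n //.
  have : t%:R <= 2 * N%:R * u%:R :> R by rewrite -!natrM ler_nat; nia.
  have A2 : 0 <= A ^+ 2 by exact: sqr_ge0.
  move=> /(ler_wpM2l A2) H; apply: (le_trans H).
  have Nu : 0 <= N%:R * u%:R :> R by rewrite mulr_ge0.
  have := ler_wpM2r Nu N2; lra.
apply: le_trans (tail_nincr t AN).
rewrite tE -[X in tail _ X]addr0; apply: le_trans (tailD _ _ _ _).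
apply: ler_pM; rewrite ?exprn_ge0 ?invr_ge0 ?tail0_ge //.
apply: le_trans (tail_mul _ _ _).
by rewrite lerXn2r ?nnegrE ?tail_ge0 ?ta // ltnW.
Qed.

End IntegerWalk.

(** * The leading lamp among many neighbouring lamps *)

Section Leads.
Context {R : realType}.
Implicit Types (v : nat -> R) (k : R).

(** Raising a maximal value among the sites by [k] produces a configuration in
   which this site leads by [k]. *)
Definition leads m k v (i : nat) : bool :=
  all (fun l => (l == i) || (v l + k <= v i)) (iota 0 m).

Lemma leadsP m k v i :
  reflect (forall l, (l < m)%N -> l != i -> v l + k <= v i) (leads m k v i).
Proof.
apply: (iffP allP) => [H l lm li|H l].
  by have := H l; rewrite mem_iota lm (negPf li) => /(_ isT).
by rewrite mem_iota => /H; case: eqP => //= _ ->.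
Qed.

(** Two sites cannot both lead. *)
Lemma sum_leads_le1 m k v : 0 < k -> \sum_(i < m) (leads m k v i)%:R <= 1 :> R.
Proof.
move=> k0; have [/existsP[i iL]|/existsPn noL] := boolP [exists i : 'I_m, leads m k v i].
  rewrite (bigD1 i) //= iL big1 ?addr0 // => l li.
  case: leadsP => // lL; have := lL i (ltn_ord i).
  rewrite -val_eqE eq_sym in li; move/leadsP: iL => /(_ l (ltn_ord l)).
  rewrite eq_sym li => /(_ isT) H1 /(_ isT) H2; exfalso; lra.
by rewrite big1 // => i _; rewrite (negPf (noL i)).
Qed.

End Leads.

Section LevelOne.
Context {R : realType}.
Variables (nu mu0 : {fsfun Zgroup -> R with 0}).
Hypotheses (nu_step : nondegenerate_step nu) (mu0_step : nondegenerate_step mu0).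
Variable d : Zgroup.
Hypotheses (d_step : 0 < convolve_pow nu 2 d)
           (d_free : injective (fun i : nat => d ^+ i)%g).

Let nu_prob : prob_meas nu. Proof. by case: nu_step. Qed.
Let nu_sym : symmetric_meas nu. Proof. by case: nu_step. Qed.
Let mu0_prob : prob_meas mu0. Proof. by case: mu0_step. Qed.
Let pt_prob t : prob_meas (convolve_pow mu0 t) := prob_convolve_pow t mu0_prob.
Let pt_ge0 t x : 0 <= convolve_pow mu0 t x := pow_ge0 mu0_prob t x.

Local Notation J := (joint nu mu0).

Definition site_values (r : Zgroup -> Zgroup) (l : nat) : R := zreal (r (d ^+ l)%g).

Lemma site_values_reset r i c l : site_values (reset r (d ^+ i)%g c) l =
  if l == i then zreal c else site_values r l.
Proof. by rewrite /site_values /reset (inj_eq d_free); case: eqP. Qed.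

(** Resampling the sites one after the other, each stays below the level with
   probability at most [1 - p]. *)
Lemma joint_none_above n (p : R) (good : seq Zgroup -> bool) (a : seq Zgroup -> R) I :
  uniq I -> p <= 1 ->
  (forall w i, i \in I -> good w -> p <= tail mu0 (switches (d ^+ i)%g w) (a w)) ->
  J n (fun w h => (good w && all (fun l => site_values (rel_lamp h) l < a w) I)%:R)
    <= (1 - p) ^+ size I.
Proof.
move=> + p1; elim: I => [|i I IH] /= => [_ _|/andP[iI uI] H].
  rewrite -[leRHS](path_expect_cst nu_prob n) -(joint_path nu mu0_prob).
  by apply: ler_joint_simple => // w h; case: (_ && _).
rewrite (joint_reset nu mu0_prob n (fun=> (d ^+ i)%g) (fun w r =>
  (good w && ((site_values r i < a w) && all (fun l => site_values r l < a w) I))%:R)).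
apply: (@le_trans _ _ (J n (fun w h => (1 - p) *
  (good w && all (fun l => site_values (rel_lamp h) l < a w) I)%:R))); last first.
  rewrite jointZ exprS ler_wpM2l ?subr_ge0 //; apply: IH => // w j jI.
  by apply: H; rewrite inE jI orbT.
apply: ler_joint_simple => // w h; set r := rel_lamp h.
have [gw|gw] /= := boolP (good w); last first.
  by rewrite mulr0 expect_eq0.
rewrite -[leRHS]mulrC; set b := all _ _.
have bE c : all (fun l => site_values (reset r (d ^+ i)%g c) l < a w) I = b.
  apply: eq_in_all => l lI; rewrite site_values_reset.
  by case: eqP lI iI => // -> ->.
under eq_expect => c do rewrite bE site_values_reset eqxx -mulnb mulnC natrM.
rewrite expectZ ler_wpM2l //.
have -> : 1 - p = expect (convolve_pow mu0 (switches (d ^+ i)%g w)) (fun=> 1) - p.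
  by rewrite expect_cst.
rewrite lerBrDr; apply: le_trans (lerD (lexx _) (H w i _ gw)) _.
  by rewrite inE eqxx.
rewrite /tail -expectD; apply: ler_expect => // c _.
by case: leP; rewrite ?add0r ?addr0.
Qed.

(** Resample the leading site, all others being fixed: if their maximum is above
   the level, the hazard rate makes a lead of [k] much less likely than a lead
   of one, and the latter events are disjoint. *)
Lemma joint_leads_hazard n m (k e : R) (good : seq Zgroup -> bool)
    (a : seq Zgroup -> R) (i : nat) : 0 <= e ->
  (forall w X, good w -> a w <= X ->
     tail mu0 (switches (d ^+ i)%g w) (X + k) <=
     e * tail mu0 (switches (d ^+ i)%g w) (X + 1)) ->
  J n (fun w h => (good w && (leads m k (site_values (rel_lamp h)) i &&
        has (fun l => (l != i) && (a w <= site_values (rel_lamp h) l)) (iota 0 m)))%:R)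
    <= e * J n (fun w h => (leads m 1 (site_values (rel_lamp h)) i)%:R).
Proof.
move=> e0 H; rewrite -jointZ.
rewrite (joint_reset nu mu0_prob n (fun=> (d ^+ i)%g) (fun w r =>
  (good w && (leads m k (site_values r) i &&
        has (fun l => (l != i) && (a w <= site_values r l)) (iota 0 m)))%:R)).
rewrite (joint_reset nu mu0_prob n (fun=> (d ^+ i)%g) (fun w r =>
  e * (leads m 1 (site_values r) i)%:R)).
apply: ler_joint_simple => // w h; set r := rel_lamp h; rewrite expectZ.
set t := switches _ _.
have e1 : 0 <= e * expect (convolve_pow mu0 t)
    (fun c => (leads m 1 (site_values (reset r (d ^+ i)%g c)) i)%:R).
  by rewrite mulr_ge0 // expect_ge0.
have [gw|gw] /= := boolP (good w); last first.
  by apply: le_trans e1; rewrite expect_eq0.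
have hE c : has (fun l => (l != i) && (a w <= site_values (reset r (d ^+ i)%g c) l)) (iota 0 m)
  = has (fun l => (l != i) && (a w <= site_values r l)) (iota 0 m).
  by apply: eq_has => l; rewrite site_values_reset; case: eqP.
under eq_expect => c do rewrite hE.
have [/hasP[l0]|_] := boolP (has _ _); last first.
  by apply: le_trans e1; rewrite expect_eq0 // => c; rewrite andbF.
rewrite mem_iota /= => l0m /andP[l0i al0].
pose o0 := Ordinal l0m.
case: (@arg_maxP _ _ _ o0 (fun l : 'I_m => val l != i) (fun l => site_values r (val l)) l0i)
  => /= j ji jmax.
have aj : a w <= site_values r j by apply: le_trans al0 (jmax o0 l0i).
apply: le_trans (le_trans (H w _ gw aj) _).
  apply: ler_expect => // c _; rewrite andbT.
  case: (leadsP m k _ i) => //= /(_ j (ltn_ord j) ji).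
  by rewrite !site_values_reset eqxx (negPf ji) => ->.
rewrite ler_wpM2l //; apply: ler_expect => // c _.
case: (leP (site_values r j + 1)) => //= jc.
case: (leadsP m (1 : R) _ i) => // [] [].
move=> l lm li; rewrite !site_values_reset eqxx (negPf li).
by apply: le_trans jc; rewrite lerD2r; exact: (jmax (Ordinal lm)).
Qed.

(** Chebyshev for a lamp that is switched at most [T] times. *)
Lemma joint_site_large n (k : R) (T : R) (good : seq Zgroup -> bool) (M : nat) i :
  (forall s, s \in finsupp mu0 -> `|zreal s| <= M%:R :> R) -> 0 < k -> 0 <= T ->
  (forall w, good w -> (switches (d ^+ i)%g w)%:R <= T) ->
  J n (fun w h => (good w && (k / 2 <= `|site_values (rel_lamp h) i|))%:R) <=
    4 * M%:R ^+ 2 * T / k ^+ 2.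
Proof.
move=> MB k0 T0 gT.
rewrite (joint_lamp nu mu0_prob n (fun=> (d ^+ i)%g)
          (fun w c => (good w && (k / 2 <= `|zreal c|))%:R)).
have k20 : 0 < k ^+ 2 by rewrite exprn_gt0.
rewrite -[leRHS](path_expect_cst nu_prob n); apply: ler_path_expect => // w _.
have [gw|gw] /= := boolP (good w); last first.
  by rewrite expect_eq0 // divr_ge0 ?(ltW k20) // mulr_ge0 // mulr_ge0 // sqr_ge0.
apply: le_trans (tail_chebyshev mu0_step MB _ _) _; first by rewrite divr_gt0.
rewrite expr_div_n invf_div mulrA ler_pM2r ?invr_gt0 //.
have := ler_wpM2l (sqr_ge0 (M%:R : R)) (gT w gw); lra.
Qed.

End LevelOne.

Section LeadsPaths.
Context {R : realType}.

(** A site that leads by [k] is either seen on an exceptional path (b1, b2), or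
   on a path with few switches, where the lead forces a value of size k / 2, or
   on a path with many switches, where one of two groups of sites stays below
   the level or the leader has another site above the level. Two groups are
   needed since the leader itself may be the one in its group. *)
Lemma leads_cases (mh m : nat) (k a : R) (v : nat -> R) (b1 b2 small big : bool) :
  0 < k -> (0 < mh)%N -> (~~ b1 -> ~~ b2 -> small || big) ->
  m = (mh + mh)%N ->
  \sum_(i < m) (leads m k v i)%:R <=
  b1%:R + b2%:R + \sum_(i < m) (small && (k / 2 <= `|v i|))%:R +
  (big && all (fun l => v l < a) (iota 0 mh))%:R +
  (big && all (fun l => v l < a) (iota mh mh))%:R +
  \sum_(i < m) (big && (leads m k v i &&
        has (fun l : nat => (l != i) && (a <= v l)) (iota 0 m)))%:R :> R.
Proof.
move=> k0 mh0 bs mE.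
have s1 : 0 <= \sum_(i < m) (small && (k / 2 <= `|v i|))%:R :> R by exact: sumr_ge0.
have s2 : 0 <= \sum_(i < m) (big && (leads m k v i &&
        has (fun l : nat => (l != i) && (a <= v l)) (iota 0 m)))%:R :> R by exact: sumr_ge0.
have pick (P : nat -> bool) i : (i < m)%N -> P i -> 1 <= \sum_(i < m) (P i)%:R :> R.
  move=> im Pi; rewrite (bigD1 (Ordinal im)) //= Pi lerDl; exact: sumr_ge0.
have nn (b : bool) : 0 <= b%:R :> R by case: b.
have [/existsP[i iL]|/existsPn noL] := boolP [exists i : 'I_m, leads m k v i];
    last first.
  rewrite big1 ?addr_ge0 // => i _; by rewrite (negPf (noL i)).
apply: le_trans (sum_leads_le1 m v k0) _.
case: b1 bs => /= bs.
  by rewrite -!addrA lerDl !addr_ge0.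
case: b2 bs => /= bs.
  by rewrite add0r -!addrA lerDl !addr_ge0.
rewrite !add0r.
have {bs} [sm|bg] : small \/ big by apply/orP; exact: bs.
  have : 1 <= \sum_(i < m) (small && (k / 2 <= `|v i|))%:R :> R.
    have [l [lm li]] : exists l, (l < m)%N /\ l != i.
      have [->|i0] := eqVneq (i : nat) 0%N; first by exists 1%N; lia.
      by exists 0%N; rewrite eq_sym; split=> //; lia.
    move/leadsP: iL => /(_ l lm li) H.
    have [vi|vi] := leP (k / 2) `|v i|; first by apply: (pick (fun i : nat => small && (k / 2 <= `|v i|)) i) => //; rewrite sm vi.
    apply: (pick (fun i : nat => small && (k / 2 <= `|v i|)) l lm); rewrite sm /=.
    rewrite ler_normr; apply/orP; right; move: vi; rewrite ltr_norml => /andP[_ vi]; lra.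
  by move=> H; rewrite -!addrA; apply: le_trans H _; rewrite lerDl !addr_ge0.
have nn1 := nn (big && all (fun l => v l < a) (iota 0 mh)).
have nn2 := nn (big && all (fun l => v l < a) (iota mh mh)).
have [A1|/allPn[l1]] := boolP (all (fun l => v l < a) (iota 0 mh)).
  rewrite bg /= in nn2 s2 *; lra.
rewrite mem_iota /= add0n -leNgt => l1m al1.
have [A2|/allPn[l2]] := boolP (all (fun l => v l < a) (iota mh mh)).
  rewrite bg /= in nn1 s2 *; lra.
rewrite mem_iota -leNgt => /andP[l2m l2m'] al2.
suff : 1 <= \sum_(i < m) (big && (leads m k v i &&
        has (fun l : nat => (l != i) && (a <= v l)) (iota 0 m)))%:R :> R.
  by move=> H; apply: (le_trans H); rewrite lerDr !addr_ge0.
apply: (pick (fun i : nat => big && (leads m k v i &&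
        has (fun l : nat => (l != i) && (a <= v l)) (iota 0 m))) i) => //.
rewrite bg iL /=; apply/hasP.
have [l1i|l1i] := eqVneq l1 i.
  exists l2; first by rewrite mem_iota /=; lia.
  by rewrite al2 andbT -l1i; apply/eqP; lia.
by exists l1; [rewrite mem_iota /=; lia|rewrite l1i al1].
Qed.

Lemma geometric_small (p e : R) : 0 < p -> p <= 1 -> 0 < e ->
  exists2 N, (0 < N)%N & (1 - p) ^+ N <= e.
Proof.
move=> p0 p1 e0.
have B N : (1 - p) ^+ N * (1 + N%:R * p) <= 1.
  elim: N => [|N IH]; first by rewrite mul0r addr0 mul1r.
  apply: le_trans IH; rewrite exprSr -mulrA ler_wpM2l ?exprn_ge0 ?subr_ge0 //.
  rewrite -natr1; have N0 : 0 <= N%:R :> R by []; have := mulr_ge0 N0 (ltW p0).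
  have := mulr_ge0 N0 (sqr_ge0 p); have := sqr_ge0 p; lra.
have q0 : 0 <= (e * p)^-1 by rewrite invr_ge0 mulr_ge0 // ltW.
have /Num.Theory.truncn_itv/andP[_ N2] := q0.
set N := (Num.truncn _).+1 in N2; exists N => //.
have Np : 1 <= e * (1 + N%:R * p).
  have ep : 0 < e * p by exact: mulr_gt0.
  have : 1 <= N%:R * (e * p) by rewrite -ler_pdivrMr // mul1r ltW.
  lra.
rewrite -[leLHS]mulr1; apply: le_trans (ler_wpM2l _ Np) _.
  by rewrite exprn_ge0 // subr_ge0.
by rewrite mulrCA -[leRHS]mulr1 ler_wpM2l ?(ltW e0).
Qed.

(** Neighbouring differences add up along the sites, and switches are twice the
   visits up to 2. *)
Lemma switches_close {G : groupType} (d : G) m (b E : R) (w : seq G) :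
  0 <= b -> 4 <= E -> m%:R * b <= E / 4 ->
  \sum_(i < m) ((visits (d ^+ i)%g w)%:R - (visits (d ^+ i * d)%g w)%:R) ^+ 2 <= b ^+ 2 ->
  forall i, (i < m)%N ->
  `|(switches (d ^+ i)%g w)%:R - (switches (d ^+ 0)%g w)%:R| <= E.
Proof.
move=> b0 E4 mb S.
have step l : (l < m)%N ->
    `|(visits (d ^+ l)%g w)%:R - (visits (d ^+ l.+1)%g w)%:R| <= b.
  move=> lm; rewrite -(@ler_pXn2r _ 2) ?nnegrE // real_normK ?num_real //.
  apply: le_trans S; rewrite (bigD1 (Ordinal lm)) //= expgSr lerDl.
  by apply: sumr_ge0 => *; exact: sqr_ge0.
have close i : (i < m)%N ->
    `|(visits (d ^+ i)%g w)%:R - (visits (d ^+ 0)%g w)%:R| <= i%:R * b.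
  elim: i => [|i IH] im; first by rewrite subrr normr0 mul0r.
  have H := ler_distD (visits (d ^+ i)%g w)%:R (visits (d ^+ i.+1)%g w)%:R
              ((visits (d ^+ 0)%g w)%:R : R).
  rewrite [X in _ <= X + _]distrC in H.
  have := IH (ltnW im); have := step i (ltnW im); rewrite -natr1; lra.
move=> i im; have := close i im.
have : i%:R * b <= E / 4 by apply: le_trans mb; rewrite ler_wpM2r // ler_nat ltnW.
have := switches_le_visits (d ^+ i)%g w; have := switches_le_visits (d ^+ 0)%g w.
rewrite -!(ler_nat R) !natrM !natrD => /andP[h1 h2] /andP[h3 h4].
rewrite !ler_norml => h5 /andP[h6 h7]; apply/andP; split; lra.
Qed.

End LeadsPaths.

Section LevelOneGap.
Context {R : realType}.
Variables (nu mu0 : {fsfun Zgroup -> R with 0}).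
Hypotheses (nu_step : nondegenerate_step nu) (mu0_step : nondegenerate_step mu0).
Variable d : Zgroup.
Hypotheses (d_step : 0 < convolve_pow nu 2 d)
           (d_free : injective (fun i : nat => d ^+ i)%g).

Let nu_prob : prob_meas nu. Proof. by case: nu_step. Qed.
Let nu_sym : symmetric_meas nu. Proof. by case: nu_step. Qed.
Let mu0_prob : prob_meas mu0. Proof. by case: mu0_step. Qed.

Local Notation J := (joint nu mu0).

(** In the wreath product of the integers by themselves, with probability close
   to one no site leads by c n^(1/4) among sufficiently many sites near the
   walker. These lamps are independent walks whose times are almost equal to
   the local time at the walker. If this time is much smaller than sqrt n, all
   values are small compared to the lead. Otherwise the values at m sites are
   spread like independent variables on the scale n^(1/4), two of them are likely
   to exceed a high level when m is large, and above this level a lead of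
   c n^(1/4) is excluded by the hazard rate. *)
Theorem level_one_gap (c e : R) : 0 < c -> 0 < e ->
  exists m : nat, exists X0 : R, [/\ (0 < m)%N, 0 < X0 &
  forall x n k, X0 <= x -> n%:R <= x -> c * Num.sqrt (Num.sqrt x) <= k%:R -> (0 < k)%N ->
  \sum_(i < m) J n (fun w h =>
     (leads m (k%:R : R) (site_values d (rel_lamp h)) i)%:R) <= 6 * e].
Proof.
move=> c0 e0.
have [M M0 MB] := step_bound mu0.
have [Cs Cs0 swC] := path_switches_bound nu_prob nu_sym d_step d_free.
have [Cf Cf0 flat] := path_visits_flat nu_prob nu_sym d_step d_free.
(* K sqrt x bounds the number of switches up to probability e; A is the level,
   in units of the square root of the time, above which the hazard rate
   excludes a lead up to probability e; the factor 2 in the lower tail bound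
   absorbs that the times agree only up to a factor 2. *)
pose K := Cs / e; have K0 : 0 < K by exact: divr_gt0.
pose A := 8 * M%:R ^+ 2 * Num.sqrt K / (e * c).
have M0' : 0 < M%:R :> R by rewrite ltr0n.
have M20 : 0 < M%:R ^+ 2 :> R by exact: exprn_gt0.
have A0 : 0 < A by rewrite !(mulr_gt0, invr_gt0) ?sqrtr_gt0 ?exprn_gt0.
have [p [t0 [p0 pt]]] := tail_lower mu0_step (mulr_ge0 (ler0n _ 2) (ltW A0)).
have p1 : p <= 1.
  apply: le_trans (pt t0 (leqnn _)) _.
  rewrite -[leRHS](expect_cst _ (prob_convolve_pow t0 mu0_prob)).
  apply: ler_expect => [v|v _]; first exact: pow_ge0.
  by case: (_ <= zreal v).
have [mh mh0 pmh] := geometric_small p0 p1 e0.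
set m := (mh + mh)%N; have m0 : (0 < m)%N by rewrite addn_gt0 mh0.
have m0' : 0 < m%:R :> R by rewrite ltr0n.
(* Up to 3 eta sqrt x switches, Chebyshev excludes the lead at all m sites. *)
pose eta := c ^+ 2 * e / (12 * M%:R ^+ 2 * m%:R).
have eta0 : 0 < eta by rewrite !(mulr_gt0, invr_gt0) ?exprn_gt0.
(* How large sqrt x must be: eta sqrt x dominates the rounding constant 4 and the
   threshold t0 of the lower tail bound, the variance of the local time profile
   is negligible, and k exceeds twice the step size. *)
pose Y := 1 + 4 / eta + t0%:R / eta + 32 * m%:R ^+ 3 * Cf / (eta ^+ 2 * e)
   + (2 * M%:R / c) ^+ 2.
have T1 : 0 <= 4 / eta by rewrite divr_ge0 // ltW.
have T2 : 0 <= t0%:R / eta by rewrite divr_ge0 // ltW.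
have T3 : 0 <= 32 * m%:R ^+ 3 * Cf / (eta ^+ 2 * e).
  by apply/ltW; rewrite !(mulr_gt0, invr_gt0) ?exprn_gt0.
have T4 : 0 <= (2 * M%:R / c) ^+ 2 by exact: sqr_ge0.
have Y1 : 1 <= Y by rewrite /Y; lra.
exists m, (Y ^+ 2); split => //; first by rewrite exprn_gt0 // (lt_le_trans ltr01).
move=> x n k Yx nx; set y := Num.sqrt x; set z := Num.sqrt y => ck k0.
have x1 : 1 <= x.
  by apply: le_trans Yx; rewrite expr_ge1 // (le_trans ler01).
have x0 : 0 <= x by rewrite (le_trans _ Yx) // sqr_ge0.
have y2 : y ^+ 2 = x by rewrite sqr_sqrtr.
have Yy : Y <= y.
  by rewrite -(@ler_pXn2r _ 2) ?nnegrE ?sqrtr_ge0 ?y2 // (le_trans ler01).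
have y0 : 0 < y by rewrite (lt_le_trans _ Yy) // (lt_le_trans ltr01).
have z2 : z ^+ 2 = y by rewrite sqr_sqrtr // ltW.
have z0 : 0 < z by rewrite sqrtr_gt0.
have E4 : 4 <= eta * y by rewrite mulrC -ler_pdivrMr //; rewrite /Y in Yy; lra.
have Et0 : t0%:R <= eta * y by rewrite mulrC -ler_pdivrMr //; rewrite /Y in Yy; lra.
have yCf : 32 * m%:R ^+ 3 * Cf <= y * (eta ^+ 2 * e).
  have ee : 0 < eta ^+ 2 * e by rewrite mulr_gt0 ?exprn_gt0.
  have : 32 * m%:R ^+ 3 * Cf / (eta ^+ 2 * e) <= y by rewrite /Y in Yy; lra.
  by rewrite ler_pdivrMr.
have Mc : 0 <= 2 * M%:R / c by rewrite divr_ge0 ?mulr_ge0 // ltW.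
have Mz : 2 * M%:R <= c * z.
  rewrite [leRHS]mulrC -ler_pdivrMr // -(@ler_pXn2r _ 2) ?nnegrE ?(ltW z0) // z2.
  by rewrite /Y in Yy; lra.
have etaE : eta * (12 * M%:R ^+ 2 * m%:R) = c ^+ 2 * e.
  by rewrite /eta; field; rewrite !gt_eqF.
have KE : e * K = Cs by rewrite /K; field; rewrite gt_eqF.
have AE : e * A * c = 8 * M%:R ^+ 2 * Num.sqrt K.
  by rewrite /A; field; rewrite !gt_eqF.
clear Yx Y1 T1 T2 T3 T4; clearbody Y; clear Y Yy.
clearbody eta A K.
have k0' : 0 < k%:R :> R by rewrite ltr0n.
have Mk : (2 * M <= k)%N by rewrite -(ler_nat R) natrM; apply: le_trans ck.
pose b := eta * y / (4 * m%:R).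
have bE : b * (4 * m%:R) = eta * y by rewrite /b; field; rewrite gt_eqF.
have b0 : 0 < b by rewrite !(mulr_gt0, invr_gt0).
have mb : m%:R * b <= eta * y / 4 by rewrite /b le_eqVlt; apply/orP; left; apply/eqP; field; rewrite gt_eqF.
pose t i w : R := (switches (d ^+ i)%g w)%:R.
pose Q w : R := \sum_(i < m) ((visits (d ^+ i)%g w)%:R - (visits (d ^+ i * d)%g w)%:R) ^+ 2.
(* Exceptional paths: too many switches, or a local time profile that is not
   flat; on the others the switches at the sites are all few or all comparable. *)
pose bad1 w := K * y < t 0%N w.
pose bad2 w := b ^+ 2 < Q w.
pose small w := all (fun i => t i w <= 3 * eta * y) (iota 0 m).
pose big w := [&& 2 * eta * y < t 0%N w, t 0%N w <= K * y &
  all (fun i => (t 0%N w / 2 <= t i w) && (t i w <= 2 * t 0%N w)) (iota 0 m)].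
pose a w := A * Num.sqrt (t 0%N w).
have dich w : ~~ bad1 w -> ~~ bad2 w -> small w || big w.
  rewrite /bad1 /bad2 -!leNgt => tK QB.
  have close := switches_close (ltW b0) E4 mb QB.
  have [ts|tb] := leP (t 0%N w) (2 * eta * y).
    apply/orP; left; apply/allP => i; rewrite mem_iota => /close.
    rewrite ler_norml -/(t i w) -/(t 0%N w) => /andP[_ ?]; lra.
  apply/orP; right; rewrite /big tb tK; apply/allP => i; rewrite mem_iota => /close.
  rewrite ler_norml -/(t i w) -/(t 0%N w) => /andP[h1 h2]; apply/andP; split; lra.
pose V (h : wreath Zgroup Zgroup) : nat -> R := site_values d (rel_lamp h).
rewrite -joint_sum.
have cases w h := @leads_cases R mh m k%:R (a w) (V h) (bad1 w) (bad2 w) (small w)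
  (big w) k0' mh0 (dich w) (erefl m).
apply: le_trans (@ler_joint_simple _ _ _ nu mu0 nu_prob mu0_prob n _ _ cases) _.
rewrite !jointD !joint_sum.
have B1 : J n (fun w _ => (bad1 w)%:R) <= e.
  rewrite (joint_path nu mu0_prob n (fun w => (bad1 w)%:R)).
  apply: le_trans (path_markov nu_prob n (mulr_gt0 K0 y0) _) _ => [w|]; first exact: ler0n.
  rewrite ler_pdivrMr ?mulr_gt0 //.
  rewrite mulrA KE.
  by apply: le_trans (swC n _) _; rewrite ler_pM2l // ler_sqrt.
have B2 : J n (fun w _ => (bad2 w)%:R) <= e.
  rewrite (joint_path nu mu0_prob n (fun w => (bad2 w)%:R)).
  apply: le_trans (path_markov nu_prob n (exprn_gt0 2 b0) _) _ => [w|].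
    by apply: sumr_ge0 => *; exact: sqr_ge0.
  rewrite ler_pdivrMr ?exprn_gt0 // path_expect_sum.
  apply: le_trans (ler_sum _ (fun i _ => flat n _)) _.
  rewrite sumr_const card_ord -[leLHS]mulr_natl.
  have ny : Num.sqrt n.+1%:R <= 2 * y.
    rewrite -(@ler_pXn2r _ 2) ?nnegrE ?sqrtr_ge0 ?mulr_ge0 ?(ltW y0) //.
    rewrite sqr_sqrtr ?ler0n // exprMn y2 -natr1.
    lra.
  have m3 : 0 <= 16 * m%:R ^+ 3 * Cf.
    by apply/ltW; rewrite !mulr_gt0 ?exprn_gt0.
  have m2 : 0 < 16 * m%:R ^+ 2 :> R by rewrite !mulr_gt0 ?exprn_gt0.
  rewrite -(ler_pM2r m2).
  have -> : e * b ^+ 2 * (16 * m%:R ^+ 2) = e * (b * (4 * m%:R)) ^+ 2 by ring.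
  rewrite bE; have H1 := ler_wpM2l m3 ny; have H2 := ler_wpM2r (ltW y0) yCf.
  lra.
have B3 : \sum_(i < m) J n (fun w h => (small w && (k%:R / 2 <= `|V h i|))%:R) <= e.
  have S i : (i < m)%N -> J n (fun w h => (small w && (k%:R / 2 <= `|V h i|))%:R) <= e / m%:R.
    move=> im; apply: le_trans (@joint_site_large R nu mu0 nu_step mu0_step d n k%:R (3 * eta * y) small M i MB k0' _ _) _.
    - by rewrite !mulr_ge0 // ltW.
    - by move=> w /allP/(_ i); rewrite mem_iota; exact.
    have kk : c ^+ 2 * y <= k%:R ^+ 2.
      by rewrite -z2 -exprMn lerXn2r ?nnegrE ?mulr_ge0 ?(ltW c0) ?(ltW z0).
    rewrite ler_pdivrMr ?exprn_gt0 //.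
    have em : 0 <= e / m%:R by rewrite divr_ge0 // ltW.
    apply: le_trans (ler_wpM2l em kk).
    have -> : e / m%:R * (c ^+ 2 * y) = c ^+ 2 * e * y / m%:R by ring.
    rewrite -etaE le_eqVlt; apply/orP; left; apply/eqP.
    by field; rewrite gt_eqF.
  apply: (@le_trans _ _ (\sum_(i < m) e / m%:R)).
    by apply: ler_sum => i _; exact: S.
  by rewrite sumr_const card_ord -[leLHS]mulr_natr divfK // gt_eqF.
have bigP w i : (i < m)%N -> big w -> [/\ 2 * eta * y < t 0%N w, t 0%N w <= K * y,
    t 0%N w / 2 <= t i w & t i w <= 2 * t 0%N w].
  by move=> im /and3P[h1 h2 /allP/(_ i)]; rewrite mem_iota => /(_ im) /andP[h3 h4].
have low w i : (i < m)%N -> big w -> p <= tail mu0 (switches (d ^+ i)%g w) (a w).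
  move=> im /(bigP _ _ im) [h1 h2 h3 h4].
  have tt : (t0 <= switches (d ^+ i)%g w)%N.
    rewrite -(ler_nat R); change (t0%:R <= t i w); lra.
  apply: le_trans (pt _ tt) _; apply: tail_nincr => //.
  have ti0 : 0 <= t i w by exact: ler0n.
  have t00 : 0 <= t 0%N w by exact: ler0n.
  have sq : Num.sqrt (t 0%N w) <= 2 * Num.sqrt (t i w).
    rewrite -(@ler_pXn2r _ 2) ?nnegrE ?mulr_ge0 ?sqrtr_ge0 //.
    rewrite exprMn !sqr_sqrtr //; lra.
  have := ler_wpM2l (ltW A0) sq.
  change (A * Num.sqrt (t 0%N w) <= A * (2 * Num.sqrt (t i w)) ->
    A * Num.sqrt (t 0%N w) <= 2 * A * Num.sqrt (t i w)); lra.
have B4 I : uniq I -> size I = mh -> {in I, forall i, (i < m)%N} ->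
    J n (fun w h => (big w && all (fun l => V h l < a w) I)%:R) <= e.
  move=> uI sI Im; apply: le_trans pmh; rewrite -sI.
  by apply: joint_none_above => // w i /Im im; exact: low.
have B5 : \sum_(i < m) J n (fun w h => (big w && (leads m k%:R (V h) i &&
        has (fun l : nat => (l != i) && (a w <= V h l)) (iota 0 m)))%:R) <= e.
  have haz w i X : (i < m)%N -> big w -> a w <= X ->
     tail mu0 (switches (d ^+ i)%g w) (X + k%:R) <=
     e * tail mu0 (switches (d ^+ i)%g w) (X + 1).
    move=> im /(bigP _ _ im) [h1 h2 h3 h4] aX.
    set s := Num.sqrt (t 0%N w) in aX *.
    have tw0 : 0 < t 0%N w by apply: lt_trans h1; rewrite !mulr_gt0.
    have s0 : 0 < s by rewrite sqrtr_gt0.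
    have s2 : s ^+ 2 = t 0%N w by rewrite sqr_sqrtr // ltW.
    have X0 : 0 < X by rewrite (lt_le_trans _ aX) // mulr_gt0.
    have sk : s * c <= Num.sqrt K * k%:R.
      have : s <= Num.sqrt K * z.
        by rewrite -sqrtrM ?(ltW K0) // ler_sqrt ?mulr_ge0 // ltW.
      have sK : 0 < Num.sqrt K by rewrite sqrtr_gt0.
      move=> sz; have H1 := ler_wpM2l (ltW sK) ck; have H2 := ler_wpM2r (ltW c0) sz.
      lra.
    rewrite -(ler_pM2r (mulr_gt0 X0 k0')).
    apply: le_trans (hazard mu0_step MB _ X0 Mk k0) _.
    rewrite [leRHS]mulrAC ler_wpM2r ?tail_ge0 //.
    have h5 : 4 * M%:R ^+ 2 * t i w <= 8 * M%:R ^+ 2 * s ^+ 2.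
      by rewrite s2; have := ler_wpM2l (ltW M20) h4; lra.
    apply: (le_trans h5).
    apply: (@le_trans _ _ (e * (A * s * k%:R))); last first.
      by rewrite ler_pM2l // ler_pM2r.
    rewrite -(ler_pM2r c0).
    have -> : e * (A * s * k%:R) * c = e * A * c * s * k%:R by ring.
    have Ms : 0 <= 8 * M%:R ^+ 2 * s by apply/ltW; rewrite !mulr_gt0.
    rewrite AE; have := ler_wpM2l Ms sk; lra.
  have S i : (i < m)%N -> J n (fun w h => (big w && (leads m k%:R (V h) i &&
        has (fun l : nat => (l != i) && (a w <= V h l)) (iota 0 m)))%:R) <=
      e * J n (fun w h => (leads m (1 : R) (V h) i)%:R).
    move=> im; apply: joint_leads_hazard => //; first exact: ltW.
    by move=> w X; exact: haz.
  apply: (@le_trans _ _ (\sum_(i < m) e * J n (fun w h => (leads m (1 : R) (V h) i)%:R))).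
    by apply: ler_sum => i _; exact: S.
  rewrite -mulr_sumr ger_pMr // -joint_sum.
  rewrite -[leRHS](path_expect_cst nu_prob n) -(joint_path nu mu0_prob).
  by apply: ler_joint_simple => // w h; exact: sum_leads_le1.
have -> : 6 * e = e + e + e + e + e + e by ring.
have I1 : {in iota 0 mh, forall i, (i < m)%N}.
  by move=> i; rewrite mem_iota => /andP[_ ih]; apply: ltn_addr.
have I2 : {in iota mh mh, forall i, (i < m)%N}.
  by move=> i; rewrite mem_iota => /andP[].
apply: lerD; last exact: B5.
apply: lerD; last exact: (B4 _ (iota_uniq mh mh) (size_iota mh mh) I2).
apply: lerD; last exact: (B4 _ (iota_uniq 0 mh) (size_iota 0 mh) I1).
apply: lerD; last exact: B3.
by apply: lerD.
Qed.

End LevelOneGap.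

(** * The innermost wreath product at the current position *)

Section Levels.
Context {R : realType}.

Lemma prob_push {G H : groupType} (f : G -> H) (mu : {fsfun G -> R with 0}) :
  prob_meas mu -> prob_meas (push_meas f mu).
Proof.
move=> pm; apply: prob_measP => [h|]; last by rewrite expect_push expect_cst.
rewrite fsfun_fun; case: ifP => // _; apply: sumr_ge0 => g _; by case: pm.
Qed.

Lemma prob_sws_walk (nu : nat -> {fsfun Zgroup -> R with 0}) j :
  (forall i, (i <= j)%N -> nondegenerate_step (nu i)) -> prob_meas (sws_walk nu j).
Proof.
elim: j => [|j IH] hnu; first by case: (hnu 0%N isT).
have pB := IH (fun i ij => hnu i (leqW ij)).
have [pA _ _] := hnu _ (leqnn j.+1).
by apply: prob_convolve; [apply: prob_convolve|]; exact: prob_push.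
Qed.

Fixpoint current j : iter_wreath j.+1 -> wreath Zgroup Zgroup :=
  if j is j'.+1 then fun h => current (wr_lamp h (wr_base h)) else fun h => h.

(** Right multiplication by this element acts on the component [current]. *)
Fixpoint at_current j : wreath Zgroup Zgroup -> iter_wreath j.+1 :=
  if j is j'.+1 then fun g => wr_delta (at_current j' g) else fun g => g.

Lemma wr_deltaM {A B : groupType} (b c : B) :
  wr_delta (b * c)%g = (wr_delta b * wr_delta c)%g :> wreath A B.
Proof.
apply: wreath_eq => [|x]; first by rewrite wr_mulg_base /= mulg1.
rewrite wr_mulgE !wr_deltaE /= invg1 mul1g.
by case: eqP => // _; rewrite mulg1.
Qed.

Lemma at_currentM j g g' : at_current j (g * g')%g = (at_current j g * at_current j g')%g.
Proof. by elim: j g g' => [//|j IH] g g' /=; rewrite IH wr_deltaM. Qed.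

Lemma current_mul j h g : current (h * at_current j g)%g = (current h * g)%g.
Proof.
elim: j h => [//|j IH] h.
transitivity (current (wr_lamp (h * wr_delta (at_current j g)) (wr_base h * 1)))%g; first by [].
by rewrite wr_mulgE mulKg wr_deltaE eqxx mulg1 IH.
Qed.

Definition add_at (d : Zgroup) (i k : nat) : wreath Zgroup Zgroup :=
  (wr_acting (d ^+ i)%g * wr_delta (1%:Z : Zgroup) ^+ k * (wr_acting (d ^+ i)%g)^-1)%g.

Lemma site_values_add_at (d : Zgroup) (d_free : injective (fun i : nat => d ^+ i)%g)
    (g : wreath Zgroup Zgroup) i k l :
  site_values d (rel_lamp (g * add_at d i k)%g) l =
  site_values d (rel_lamp g) l + (if l == i then k%:R else 0) :> R.
Proof.
have deltaX : (wr_delta (1%:Z : Zgroup) ^+ k)%g =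
    wr_delta (k%:Z : Zgroup) :> wreath Zgroup Zgroup.
  elim: k => [|k IH].
    rewrite expg0; apply: wreath_eq => // x; rewrite wr_deltaE fsfun0E.
    by case: ifP.
  by rewrite expgS IH -wr_deltaM; congr wr_delta; rewrite -[k.+1]add1n PoszD.
have lampE z : wr_lamp (add_at d i k) z = if z == (d ^+ i)%g then (k%:Z : Zgroup) else 1%g.
  rewrite /add_at deltaX. rewrite !wr_mulgE wr_deltaE wr_invE !fsfun0E invg1 mulg1 mul1g.
  by rewrite (can2_eq (mulVKg _) (mulKg _)) mulg1.
have baseE : wr_base (add_at d i k) = 1%g.
  by rewrite /add_at deltaX !wr_mulg_base [X in (X * _)%g]mulg1 mulgV.
rewrite /site_values /rel_lamp wr_mulg_base baseE mulg1 wr_mulgE mulKg lampE.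
rewrite zrealM (inj_eq d_free); case: eqP => // _.
Qed.

(** The power with exponent 2^(-j). *)
Fixpoint iter_sqrt (j : nat) (x : R) : R :=
  if j is j'.+1 then iter_sqrt j' (Num.sqrt x) else x.

Lemma iter_sqrtM j (x y : R) : 0 <= x -> iter_sqrt j (x * y) = iter_sqrt j x * iter_sqrt j y.
Proof.
by elim: j x y => [//|j IH] x y x0 /=; rewrite sqrtrM // IH // sqrtr_ge0.
Qed.

Lemma iter_sqrt_gt0 j (x : R) : 0 < x -> 0 < iter_sqrt j x.
Proof. by elim: j x => [//|j IH] x x0 /=; rewrite IH // sqrtr_gt0. Qed.

(** At an outer level, the lamp at the walker is a run of the inner walk whose
   time is the number of switches there, at most a multiple of the square root
   of the outer time up to a small probability. The inner estimate is uniform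
   over all shorter times, so nothing is lost when this number is small. *)
Theorem current_gap (nu : nat -> {fsfun Zgroup -> R with 0}) (d : Zgroup) j :
  (forall i, (i <= j.+1)%N -> nondegenerate_step (nu i)) ->
  0 < convolve_pow (nu 1%N) 2 d -> injective (fun i : nat => d ^+ i)%g ->
  forall c e : R, 0 < c -> 0 < e ->
  exists m : nat, exists X0 : R, [/\ (0 < m)%N, 0 < X0 &
  forall x n k, X0 <= x -> n%:R <= x -> c * iter_sqrt j.+2 x <= k%:R -> (0 < k)%N ->
  \sum_(i < m) expect (convolve_pow (sws_walk nu j.+1) n) (fun h =>
     (leads m (k%:R : R) (site_values d (rel_lamp (current h))) i)%:R) <= e].
Proof.
move=> + d_step d_free; elim: j => [|j IH] hnu c e c0 e0.
  have e60 : 0 < e / 6 by exact: divr_gt0.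
  have [m [X0 [m0 X00 H]]] :=
    level_one_gap (hnu 1%N isT) (hnu 0%N isT) d_step d_free c0 e60.
  exists m, X0; split => // x n k Xx nx ck k0.
  have := H x n k Xx nx ck k0; rewrite mulrC divfK //.
  by under eq_bigr do rewrite -expect_joint.
have hnu' i (ij : (i <= j.+1)%N) : nondegenerate_step (nu i) := hnu i (leqW ij).
have hj := hnu _ (leqnn j.+2).
have [nu_prob nu_sym _] := hj.
have [dj [_ dj_step dj_free]] := step_direction hj.
have [C C0 swC] := path_switches_bound nu_prob nu_sym dj_step dj_free.
have e20 : 0 < e / 2 by exact: divr_gt0.
pose K := C / (e / 2); have K0 : 0 < K by exact: divr_gt0.
have c'0 : 0 < c / iter_sqrt j.+2 K by rewrite divr_gt0 // iter_sqrt_gt0.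
have [m [X0 [m0 X00 H]]] := IH hnu' _ _ c'0 e20.
exists m, ((X0 / K) ^+ 2); split => // [|x n k Xx nx ck k0].
  by rewrite exprn_gt0 // divr_gt0.
have x0 : 0 < x by rewrite (lt_le_trans _ Xx) // exprn_gt0 // divr_gt0.
have s0 : 0 < Num.sqrt x by rewrite sqrtr_gt0.
have k0' : 0 < k%:R :> R by rewrite ltr0n.
pose muB := sws_walk nu j.+1; have pB : prob_meas muB by exact: prob_sws_walk.
pose P t := \sum_(i < m) expect (convolve_pow muB t) (fun h =>
     (leads m (k%:R : R) (site_values d (rel_lamp (current h))) i)%:R).
have -> : \sum_(i < m) expect (convolve_pow (sws_walk nu j.+2) n) (fun h =>
     (leads m (k%:R : R) (site_values d (rel_lamp (current h))) i)%:R) =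
  path_expect (nu j.+2) n (fun w => P (switches 1%g w)).
  rewrite path_expect_sum; apply: eq_bigr => i _; rewrite expect_joint.
  rewrite -(joint_lamp _ pB n (fun=> 1%g) (fun _ h =>
    (leads m k%:R (site_values d (rel_lamp (current h))) i)%:R)).
  by apply: eq_joint => w h; rewrite /rel_lamp mulg1.
have P1 t : P t <= 1.
  rewrite /P -expect_sum -[leRHS](expect_cst _ (prob_convolve_pow t pB)).
  by apply: ler_expect => [h|h _]; [exact: pow_ge0|exact: sum_leads_le1].
have Ps t : t%:R <= K * Num.sqrt x -> P t <= e / 2.
  move=> tK; have cE : c / iter_sqrt j.+2 K * iter_sqrt j.+2 (K * Num.sqrt x) <= k%:R.
    by rewrite (iter_sqrtM j.+2 _ (ltW K0)) mulrA divfK // gt_eqF // iter_sqrt_gt0.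
  have XK : 0 <= X0 / K by rewrite divr_ge0 // ltW.
  apply: (H (K * Num.sqrt x)) => //.
    rewrite mulrC -ler_pdivrMr // -(@ler_pXn2r _ 2) ?nnegrE ?sqrtr_ge0 ?XK //.
    by rewrite sqr_sqrtr // ltW.
apply: (@le_trans _ _ (path_expect (nu j.+2) n (fun w =>
   (K * Num.sqrt x < (switches 1%g w)%:R)%R%:R + e / 2))).
  apply: ler_path_expect => // w _.
  case: (ltP (K * Num.sqrt x)) => [_|/Ps]; last by rewrite add0r.
  by apply: le_trans (P1 _) _; rewrite lerDl ltW.
rewrite path_expectD path_expect_cst //.
have B : path_expect (nu j.+2) n (fun w => (K * Num.sqrt x < (switches 1%g w)%:R)%R%:R) <= e / 2.
  apply: le_trans (path_markov nu_prob n (mulr_gt0 K0 s0) _) _ => [w|]; first exact: ler0n.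
  have KE : e / 2 * K = C by rewrite /K; field; rewrite gt_eqF.
  rewrite ler_pdivrMr; last exact: mulr_gt0.
  rewrite mulrA KE; apply: le_trans (swC n _) _.
  by rewrite ler_pM2l // ler_sqrt // ltW.
by apply: le_trans (lerD B (lexx _)) _; rewrite -mulrDr; lra.
Qed.

End Levels.

(** * The drift *)

Section Range.
Context {R : realType}.

(** Steps are listed from the latest, so this measures the path in reversed order,
   which by symmetry has the same law. *)
Fixpoint reach (z : Zgroup) (w : seq Zgroup) : nat :=
  if w is s :: w' then maxn (absz (z : int)) (reach (z * s)%g w') else absz (z : int).

Lemma absz_zreal (z : Zgroup) : (absz (z : int))%:R = `|zreal z| :> R.
Proof. by rewrite /zreal -intr_norm -abszE. Qed.

Lemma absz_le_reach z w : (absz (z : int) <= reach z w)%N.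
Proof. by case: w => [|s w] //=; rewrite leq_maxl. Qed.

Variable nu : {fsfun Zgroup -> R with 0}.
Hypotheses (nu_prob : prob_meas nu) (nu_sym : symmetric_meas nu).
Variable M : nat.
Hypothesis M_bound : forall s, s \in finsupp nu -> `|zreal s| <= M%:R :> R.

Lemma reach_le z w : all (mem (finsupp nu)) w ->
  (reach z w <= absz (z : int) + size w * M)%N.
Proof.
elim: w z => [|s w IH] z /=; first by rewrite addn0.
move=> /andP[/M_bound sM /IH wM]; rewrite geq_max leq_addr /=.
apply: leq_trans (wM _) _.
have H1 : (absz ((z * s)%g : int) <= absz (z : int) + absz (s : int))%N.
  have E : forall a b : int, (absz (a + b)%R <= absz a + absz b)%N by lia.
  exact: E.
have H2 : (absz (s : int) <= M)%N by rewrite -(ler_nat R) absz_zreal.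
by rewrite mulSn addnA leq_add2r (leq_trans H1) // leq_add2l.
Qed.

Let mean_abs (z : Zgroup) : `|zreal z| <= expect nu (fun s => `|zreal (z * s)%g|) :> R.
Proof.
have : `|zreal z| *+ 2 <= expect nu (fun s => `|zreal (z * s)%g|) *+ 2 :> R.
  rewrite [leRHS]mulr2n {2}(expect_sym _ nu_sym) -expectD -[leLHS](expect_cst _ nu_prob).
  apply: ler_expect => [x|s _]; first by case: nu_prob.
  rewrite !zrealM zrealV -normrMn; apply: le_trans (ler_normD _ _).
  by rewrite le_eqVlt; apply/orP; left; apply/eqP; congr (`|_|); ring.
by rewrite ler_pMn2r.
Qed.

Let mean_sqr (z : Zgroup) : expect nu (fun s => zreal (z * s)%g ^+ 2) <=
   zreal z ^+ 2 + M%:R ^+ 2 :> R.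
Proof.
have mean0 := symmetric_mean nu_sym.
under eq_expect => s do rewrite zrealM sqrrD -mulrnAl.
rewrite !expectD expect_cst // expectZ mean0 mulr0 addr0 lerD2l.
rewrite -[leRHS](expect_cst _ nu_prob).
apply: ler_expect => [x|s sn]; first by case: nu_prob.
by rewrite -real_normK ?num_real // lerXn2r ?nnegrE ?M_bound.
Qed.

(** Maximal inequality. With running maximum m and position z, the quantity
   m^2 - 2m|z| decreases on average, since |z| increases on average and the
   quantity is minimal in m at m = |z|. At the end it is at least
   m^2 / 2 - 2 z^2, which compares the maximum with the variance. *)
Lemma reach_maximal n (m : nat) (z : Zgroup) : (absz (z : int) <= m)%N ->
  path_expect nu n (fun w => (maxn m (reach z w))%:R ^+ 2 / 2) <=
  m%:R ^+ 2 - 2 * m%:R * `|zreal z| + 2 * (zreal z ^+ 2 + n%:R * M%:R ^+ 2).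
Proof.
elim: n m z => [|n IH] m z zm /=.
  rewrite (maxn_idPl zm) mul0r addr0 -(real_normK (num_real (zreal z))).
  set a := `|zreal z|; have := sqr_ge0 (m%:R - 2 * a); lra.
have maxE s w : maxn m (maxn (absz (z : int)) (reach (z * s)%g w)) =
    maxn (maxn m (absz ((z * s)%g : int))) (reach (z * s)%g w).
  rewrite maxnA (maxn_idPl zm) -maxnA; congr maxn.
  by apply/esym/maxn_idPr; exact: absz_le_reach.
apply: (@le_trans _ _ (expect nu (fun s => m%:R ^+ 2 - 2 * m%:R * `|zreal (z * s)%g|
   + 2 * (zreal (z * s)%g ^+ 2 + n%:R * M%:R ^+ 2)))).
  apply: ler_expect => [x|s _]; first by case: nu_prob.
  under eq_path_expect => w _ do rewrite maxE.
  apply: le_trans (IH _ _ (leq_maxr _ _)) _; rewrite lerD2r.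
  have [mz|mz] := leqP (absz ((z * s)%g : int)) m => //.
  rewrite -absz_zreal.
  set a : R := (absz _)%:R; have := sqr_ge0 (m%:R - a); lra.
rewrite expectD expectB expect_cst // !expectZ expectD expect_cst // -natr1.
have := ler_wpM2l (ler0n R m) (mean_abs z); have := mean_sqr z; lra.
Qed.

Lemma expect_reach n : path_expect nu n (fun w => (reach 1%g w)%:R) <=
  (1 + 4 * M%:R ^+ 2) / 2 * Num.sqrt n%:R.
Proof.
case: n => [|n]; first by rewrite /= sqrtr0 mulr0.
set s := Num.sqrt _.
have s0 : 0 < s by rewrite sqrtr_gt0.
have s2 : s ^+ 2 = n.+1%:R by rewrite sqr_sqrtr.
have := @reach_maximal n.+1 0%N 1%g (leqnn 0).
rewrite [X in _ <= X](_ : _ = 2 * (n.+1%:R * M%:R ^+ 2)); last first.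
  by rewrite zreal1 normr0; ring.
under eq_path_expect do rewrite max0n.
move=> H; have {}H : path_expect nu n.+1 (fun w => (reach 1%g w)%:R ^+ 2) <= 4 * (s ^+ 2 * M%:R ^+ 2).
  move: H; under eq_path_expect do rewrite mulrC.
  rewrite path_expectZ s2; lra.
have le1 : path_expect nu n.+1 (fun w => (reach 1%g w)%:R) <=
   path_expect nu n.+1 (fun w => (2 * s)^-1 * (reach 1%g w)%:R ^+ 2 + s / 2).
  apply: ler_path_expect => // w _; set r := _%:R.
  have s20 : 0 < 2 * s by exact: mulr_gt0.
  rewrite -(ler_pM2l s20) mulrDr mulVKf ?gt_eqF //.
  have := sqr_ge0 (r - s); lra.
apply: (le_trans le1); rewrite path_expectD path_expectZ path_expect_cst //.
have s20 : 0 <= (2 * s)^-1 by rewrite invr_ge0 mulr_ge0 // ltW.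
apply: le_trans (lerD (ler_wpM2l s20 H) (lexx _)) _.
by rewrite le_eqVlt; apply/orP; left; apply/eqP; field; rewrite gt_eqF.
Qed.

End Range.

Section Growth.
Context {R : realType}.

Lemma ler_iter_sqrt j (x y : R) : 0 <= x -> x <= y -> iter_sqrt j x <= iter_sqrt j y.
Proof.
elim: j x y => [//|j IH] x y x0 xy /=; apply: IH; first exact: sqrtr_ge0.
by rewrite ler_sqrt // (le_trans x0).
Qed.

Lemma growthS j (x : R) : 0 <= x ->
  x / iter_sqrt j.+1 x = Num.sqrt x * (Num.sqrt x / iter_sqrt j (Num.sqrt x)).
Proof. by move=> x0; rewrite mulrA -expr2 sqr_sqrtr. Qed.

Lemma growth_nondecr j (x y : R) : 0 <= x -> x <= y -> 0 < y ->
  x / iter_sqrt j x <= y / iter_sqrt j y.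
Proof.
elim: j x y => [|j IH] x y x0 xy y0.
  have yy : y / y = 1 by rewrite divff ?gt_eqF.
  rewrite /= yy; have [->|x1] := eqVneq x 0; first by rewrite mul0r.
  by rewrite divff.
have sxy : Num.sqrt x <= Num.sqrt y by rewrite ler_sqrt // (le_trans x0).
rewrite !growthS ?(ltW y0) //; apply: ler_pM; rewrite ?sqrtr_ge0 //.
  have [->|x1] := eqVneq x 0; first by rewrite sqrtr0 mul0r.
  by rewrite divr_ge0 ?sqrtr_ge0 // ltW // iter_sqrt_gt0 // sqrtr_gt0 lt_neqAle eq_sym x1.
by apply: IH; rewrite ?sqrtr_ge0 // sqrtr_gt0.
Qed.

(** Concavity of x^(1 - 2^(-j)), in the form of a linear bound that is exact up to
   a factor 2 at x = y. *)
Lemma growth_chord j (x y : R) : 0 <= x -> 0 < y ->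
  x / iter_sqrt j x <= y / iter_sqrt j y * (1 + x / y).
Proof.
move=> x0 y0; have iy := iter_sqrt_gt0 j y0.
have [xy|xy] := leP x y.
  apply: le_trans (growth_nondecr j x0 xy y0) _.
  by rewrite ler_peMr ?divr_ge0 ?lerDl ?divr_ge0 // ltW.
have E : y / iter_sqrt j y * (1 + x / y) = (x + y) / iter_sqrt j y.
  by field; rewrite !gt_eqF.
have ix := iter_sqrt_gt0 j (lt_trans y0 xy).
have ixy := ler_iter_sqrt j (ltW y0) (ltW xy).
rewrite E; apply: ler_pM => //; first by rewrite invr_ge0 ltW.
  by rewrite lerDl ltW.
by rewrite lef_pV2 ?posrE.
Qed.

Lemma growth_ge1 j (x : R) : 1 <= x -> 1 <= x / iter_sqrt j x.
Proof.
move=> x1; have x0 := lt_le_trans ltr01 x1.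
apply: le_trans (growth_nondecr j ler01 x1 x0).
suff -> : iter_sqrt j 1 = 1 :> R by rewrite divr1.
by elim: j => [//|j IH] /=; rewrite sqrtr1.
Qed.

End Growth.

Section Seminorms.
Context {R : realType}.

(** The drift bound is proved for every such function, so that the induction on
   the level can restrict a length to the lamp group without any comparison of
   generating sets. *)
Record seminorm {G : groupType} (N : G -> R) : Prop := Seminorm {
  seminorm_ge0 : forall x, 0 <= N x;
  seminorm1 : N 1%g = 0;
  seminormM : forall x y, N (x * y)%g <= N x + N y }.

Lemma seminormX {G : groupType} (N : G -> R) x k : seminorm N ->
  N (x ^+ k)%g <= k%:R * N x.
Proof.
move=> sN; elim: k => [|k IH]; first by rewrite expg0 seminorm1 // mul0r.
rewrite expgS -natr1 mulrDl mul1r addrC.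
by apply: le_trans (seminormM sN _ _) _; rewrite lerD2l.
Qed.

Lemma seminorm_int (N : Zgroup -> R) (sN : seminorm N) (v : Zgroup) :
  N v <= (N (1%:Z : Zgroup) + N (- 1%:Z : Zgroup)) * `|zreal v|.
Proof.
have n0 := seminorm_ge0 sN.
have E (s : Zgroup) k : (s ^+ k)%g = ((s : int) *+ k) :> int.
  by elim: k => [//|k IH]; rewrite expgS mulrS -IH.
have [k [s [vE vk]]] : exists k (s : Zgroup), v = (s ^+ k)%g /\
    (s = 1%:Z :> int \/ s = - 1%:Z :> int).
  exists (absz (v : int)).
  have [v0|v0] := leP 0 (v : int).
    by exists (1%:Z : Zgroup); split; [rewrite E; lia|left].
  by exists (- 1%:Z : Zgroup); split; [rewrite E; lia|right].
have kv : `|zreal v| = k%:R :> R.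
  rewrite -absz_zreal; congr (_%:R); rewrite vE E; case: vk => ->; lia.
rewrite kv {1}vE; apply: le_trans (seminormX _ _ sN) _; rewrite mulrC ler_wpM2r //.
by case: vk => ->; rewrite ?lerDl ?lerDr.
Qed.

Lemma seminorm_comp {G H : groupType} (f : G -> H) (N : H -> R) :
  f 1%g = 1%g -> {morph f : x y / (x * y)%g} -> seminorm N -> seminorm (N \o f).
Proof.
move=> f1 fM sN; split => [x||x y] /=; first exact: seminorm_ge0.
  by rewrite f1 seminorm1.
by rewrite fM; exact: seminormM.
Qed.

Lemma wr_delta1 {A B : groupType} : wr_delta 1%g = 1%g :> wreath A B.
Proof.
by apply: wreath_eq => // x; rewrite wr_deltaE fsfun0E; case: ifP.
Qed.

Lemma wr_actingM {A B : groupType} (a a' : A) :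
  wr_acting (a * a')%g = (wr_acting a * wr_acting a')%g :> wreath A B.
Proof. by apply: wreath_eq => // x; rewrite wr_mulgE !fsfun0E mulg1. Qed.

Lemma rel_lamp_acting {A B : groupType} (h : wreath A B) s y :
  rel_lamp (h * wr_acting s)%g y = rel_lamp h (s * y)%g.
Proof. by rewrite /rel_lamp wr_mulgE fsfun0E mulg1 wr_mulg_base /= -mulgA. Qed.

Lemma rel_lamp_delta {A B : groupType} (h : wreath A B) b y :
  rel_lamp (h * wr_delta b)%g y = (rel_lamp h y * if y == 1 then b else 1)%g.
Proof. by rewrite /rel_lamp wr_mulgE wr_mulg_base /= mulg1 mulKg wr_deltaE. Qed.

Section Tour.
Context {B : groupType}.
Variable N : wreath Zgroup B -> R.
Hypothesis sN : seminorm N.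

Let cA : R := N (wr_acting (1%:Z : Zgroup)) + N (wr_acting (- 1%:Z : Zgroup)).
Let Nd (b : B) : R := N (wr_delta b).

Lemma seminorm_acting (s : Zgroup) : N (wr_acting s) <= cA * `|zreal s|.
Proof.
apply: (@seminorm_int (N \o @wr_acting Zgroup B)).
by apply: seminorm_comp => //; exact: wr_actingM.
Qed.

(** Repair the lamp at the walker, step to the right, and continue. *)
Lemma seminorm_tour_right K (h : wreath Zgroup B) :
  (forall y : Zgroup, rel_lamp h y != 1%g -> exists2 i : nat, (i < K)%N & y = i%:Z :> int) ->
  N h <= \sum_(i < K) Nd (rel_lamp h (i%:Z : Zgroup)) +
         cA * (K%:R + `|zreal (wr_base h)| + K%:R).
Proof.
have n0 := seminorm_ge0 sN.
have cA0 : 0 <= cA by rewrite addr_ge0.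
elim: K h => [|K IH] h supp.
  rewrite big_ord0 add0r mulr0n add0r addr0.
  have -> : h = wr_acting (wr_base h).
    apply: wreath_eq => // x; rewrite fsfun0E.
    have := supp ((wr_base h)^-1 * x)%g; rewrite /rel_lamp mulVKg.
    by case: eqP => // _ /(_ isT)[].
  exact: seminorm_acting.
pose b := rel_lamp h 1%g.
pose h' := (h * wr_delta b^-1 * wr_acting (1%:Z : Zgroup))%g.
have hE : h = (h' * wr_acting (- 1%:Z : Zgroup) * wr_delta b)%g.
  rewrite /h' -!mulgA [(wr_acting _ * (wr_acting _ * _))%g]mulgA -wr_actingM.
  rewrite [wr_acting 1%g](_ : _ = 1%g) // mul1g.
  by rewrite -wr_deltaM mulVg wr_delta1 mulg1.
have relE (y : Zgroup) : rel_lamp h' y =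
    (rel_lamp h ((1%:Z : Zgroup) * y) * if (1%:Z : Zgroup) * y == 1 then b^-1 else 1)%g.
  by rewrite /h' rel_lamp_acting rel_lamp_delta.
have rel_shift (i : nat) : rel_lamp h' (i%:Z : Zgroup) = rel_lamp h (i.+1%:Z : Zgroup).
  rewrite relE; have -> : ((1%:Z : Zgroup) * (i%:Z : Zgroup))%g = (i.+1%:Z : Zgroup).
    by rewrite -[i.+1]add1n PoszD.
  by rewrite mulg1.
have supp' (y : Zgroup) : rel_lamp h' y != 1%g ->
    exists2 i : nat, (i < K)%N & y = i%:Z :> int.
  rewrite relE; have [y1|y1] := eqVneq ((1%:Z : Zgroup) * y)%g 1%g.
    by rewrite y1 mulgV eqxx.
  rewrite mulg1 => /supp[[|i] iK yi].
    by case/eqP: y1; exact: yi.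
  exists i => //; have : (1 + (y : int) = i.+1%:Z)%R by exact: yi.
  by lia.
have base' : zreal (wr_base h') = zreal (wr_base h) + 1 :> R.
  by rewrite /h' !wr_mulg_base !zrealM zreal1 addr0.
rewrite {1}hE; apply: le_trans (seminormM sN _ _) _.
apply: le_trans (lerD (seminormM sN _ _) (lexx _)) _.
apply: le_trans (lerD (lerD (IH h' supp') (seminorm_acting _)) (lexx _)) _.
rewrite big_ord_recl /= -/(Nd b) base'.
under eq_bigr do rewrite rel_shift.
have -> : Nd (rel_lamp h (0 : Zgroup)) = Nd b by [].
have -> : `|zreal (- 1%:Z : Zgroup)| = 1 :> R by rewrite /zreal normrN1.
have := ler_normD (zreal (wr_base h)) (1 : R); rewrite normr1 => T.
have := ler_wpM2l cA0 T; rewrite -natr1; lra.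
Qed.

(** First go to the left end of the interval that contains all lit lamps. *)
Lemma seminorm_tour (D : nat) (h : wreath Zgroup B) :
  (absz (wr_base h : int) <= D)%N ->
  (forall y : Zgroup, rel_lamp h y != 1%g -> (absz (y : int) <= D)%N) ->
  N h <= \sum_(i < (2 * D).+1) Nd (rel_lamp h (i%:Z - D%:Z : Zgroup)) +
         cA * (7 * D%:R + 2).
Proof.
move=> aD supp; have n0 := seminorm_ge0 sN.
have cA0 : 0 <= cA by rewrite addr_ge0.
pose h' := (h * wr_acting (- D%:Z : Zgroup))%g.
have hE : h = (h' * wr_acting (D%:Z : Zgroup))%g.
  rewrite /h' -!mulgA -wr_actingM [X in wr_acting X](_ : _ = 1%g); last exact: addNr.
  by rewrite [wr_acting 1%g](_ : _ = 1%g) // mulg1.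
have relE (y : Zgroup) : rel_lamp h' y = rel_lamp h ((y : int) - D%:Z : Zgroup).
  by rewrite /h' rel_lamp_acting; congr rel_lamp; exact: addrC.
have supp' (y : Zgroup) : rel_lamp h' y != 1%g ->
    exists2 i : nat, (i < (2 * D).+1)%N & y = i%:Z :> int.
  rewrite relE => /supp H; exists (absz (y : int)); lia.
rewrite {1}hE; apply: le_trans (seminormM sN _ _) _.
apply: le_trans (lerD (seminorm_tour_right supp') (seminorm_acting _)) _.
under eq_bigr do rewrite relE.
have -> : `|zreal (D%:Z : Zgroup)| = D%:R :> R by rewrite /zreal normr_nat.
have b' : `|zreal (wr_base h')| <= 2 * D%:R :> R.
  rewrite /h' wr_mulg_base zrealM; apply: le_trans (ler_normD _ _) _.
  have : `|zreal (wr_base h)| <= D%:R :> R by rewrite -absz_zreal ler_nat.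
  have -> : `|zreal (- D%:Z : Zgroup)| = D%:R :> R by rewrite /zreal mulrNz normrN normr_nat.
  lra.
have := ler_wpM2l cA0 b'; rewrite -[(2 * D).+1%:R]natr1 [(2 * D)%:R]natrM; lra.
Qed.

End Tour.
End Seminorms.

Section Drift.
Context {R : realType}.

Lemma sum_ltn_le K a : \sum_(i < K) (i < a)%N%:R <= a%:R :> R.
Proof.
suff H : \sum_(i < K) (i < a)%N%:R <= (minn K a)%:R :> R.
  by apply: le_trans H _; rewrite ler_nat geq_minr.
elim: K => [|K IH]; first by rewrite big_ord0.
rewrite big_ord_recr /=; apply: le_trans (lerD IH (lexx _)) _.
by rewrite -natrD ler_nat; case: ltnP => /=; lia.
Qed.

(** Here [|v| <= v^2 / (2 s) + s / 2] with s = sqrt n replaces Cauchy-Schwarz. *)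
Lemma drift_int (nu : {fsfun Zgroup -> R with 0}) (N : Zgroup -> R) :
  nondegenerate_step nu -> seminorm N -> exists2 C : R, 0 < C &
  forall n, expect (convolve_pow nu n) N <= C * (n%:R / iter_sqrt 1 n%:R).
Proof.
move=> hnu sN; have [M _ MB] := step_bound nu.
pose c := N (1%:Z : Zgroup) + N (- 1%:Z : Zgroup) + 1.
have n0 := seminorm_ge0 sN.
have c0 : 0 < c by have := n0 (1%:Z : Zgroup); have := n0 (- 1%:Z : Zgroup); rewrite /c; lra.
have [nu_prob _ _] := hnu.
exists (c * (1 + M%:R ^+ 2)) => [|[|n]].
- by rewrite mulr_gt0 // ltr_pwDl // sqr_ge0.
- by rewrite expect_dirac1 seminorm1 // mul0r mulr0.
rewrite growthS // /= divff ?gt_eqF ?sqrtr_gt0 // mulr1.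
set s := Num.sqrt _; have s0 : 0 < s by rewrite sqrtr_gt0.
have s2 : s ^+ 2 = n.+1%:R by rewrite sqr_sqrtr.
have pp := prob_convolve_pow n.+1 nu_prob.
apply: (@le_trans _ _ (expect (convolve_pow nu n.+1)
    (fun v => c * ((2 * s)^-1 * zreal v ^+ 2 + s / 2)))).
  apply: ler_expect => [x|v _]; first by case: pp.
  apply: le_trans (seminorm_int sN v) _.
  apply: (@le_trans _ _ (c * `|zreal v|)); first by rewrite ler_wpM2r // /c lerDl.
  have s20 : 0 < 2 * s by exact: mulr_gt0.
  rewrite ler_pM2l // -(ler_pM2l s20) mulrDr mulVKf ?gt_eqF //.
  rewrite -(real_normK (num_real (zreal v))); set a := `|zreal v|.
  have := sqr_ge0 (a - s); lra.
rewrite expectZ expectD expectZ expect_cst // -mulrA ler_pM2l //.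
have s20 : 0 <= (2 * s)^-1 by rewrite invr_ge0 mulr_ge0 // ltW.
apply: le_trans (lerD (ler_wpM2l s20 (expect_sqr_le hnu MB _)) (lexx _)) _.
have -> : (2 * s)^-1 * (M%:R ^+ 2 * n.+1%:R) + s / 2 = (M%:R ^+ 2 + 1) / 2 * s.
  by rewrite -s2; field; rewrite gt_eqF.
by rewrite ler_pM2r //; have := sqr_ge0 (M%:R : R); lra.
Qed.

Section WreathDrift.
Context {B : groupType}.
Variables (nu : {fsfun Zgroup -> R with 0}) (muB : {fsfun B -> R with 0}).
Hypotheses (nu_step : nondegenerate_step nu) (muB_prob : prob_meas muB).
Variables (j : nat) (N : wreath Zgroup B -> R) (C' : R).
Hypotheses (sN : seminorm N) (C'0 : 0 < C')
  (lamp_drift : forall t, expect (convolve_pow muB t) (fun b => N (wr_delta b)) <=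
                          C' * (t%:R / iter_sqrt j.+1 t%:R)).

Let nu_prob : prob_meas nu. Proof. by case: nu_step. Qed.
Let nu_sym : symmetric_meas nu. Proof. by case: nu_step. Qed.

Let cA : R := N (wr_acting (1%:Z : Zgroup)) + N (wr_acting (- 1%:Z : Zgroup)).

(** The translation [z] makes the clauses on the final position and on the lit
   lamps inductive, since a new step moves the starting point of the reach. *)
Definition path_invariant (w : seq Zgroup) (h : wreath Zgroup B) : Prop :=
  [/\ all (mem (finsupp nu)) w,
      forall z : Zgroup, (absz ((z * wr_base h)%g : int) <= reach z w)%N &
      forall z y : Zgroup, rel_lamp h y != 1%g -> (absz ((z * y^-1)%g : int) <= reach z w)%N].

Lemma path_invariant_step s b b' w h : s \in finsupp nu -> path_invariant w h ->
  path_invariant (s :: w) (h * sws_step s b b')%g.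
Proof.
move=> sn [ws bh rh]; split; first by rewrite /= sn.
  move=> z; have -> : wr_base (h * sws_step s b b')%g = (s * wr_base h)%g.
    by rewrite wr_mulg_base /sws_step !wr_mulg_base /= mul1g mulg1; exact: (@addrC int).
  by rewrite mulgA; apply: leq_trans (bh (z * s)%g) _; exact: leq_maxr.
move=> z y; rewrite rel_lamp_step /rel_step /=.
have [y1 _|y1] := eqVneq y 1%g; first by rewrite y1 invg1 mulg1 leq_maxl.
have [sy _|sy] := eqVneq (s * y)%g 1%g.
  have -> : (y^-1 = s)%g by rewrite -[RHS](mulgK y) sy mul1g.
  by apply: leq_trans (absz_le_reach (z * s)%g w) _; exact: leq_maxr.
rewrite !mulg1 => /(rh (z * s)%g).
have -> : ((z * s) * (s * y)^-1 = z * y^-1)%g.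
  by rewrite invgM mulgA -[(z * s * y^-1)%g]mulgA [(s * y^-1)%g](@addrC int) mulgA mulgK.
by move=> H; apply: leq_trans H _; exact: leq_maxr.
Qed.

(** The tour visits an interval that depends on the path; [K] is a deterministic
   bound for its length, which makes the sum over sites finite and lets each
   lamp be resampled. *)
Lemma joint_tour (M K : nat) n : (forall s, s \in finsupp nu -> `|zreal s| <= M%:R :> R) ->
  K = (2 * (n * M)).+1 ->
  expect (convolve_pow (switch_walk_switch nu muB) n) N <=
  path_expect nu n (fun w => cA * (7 * (reach 1%g w)%:R + 2) +
    \sum_(i < K) ((i < (2 * reach 1%g w).+1)%N)%:R *
      expect (convolve_pow muB (switches (i%:Z - (reach 1%g w)%:Z : Zgroup) w))
       (fun b => N (wr_delta b))).
Proof.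
move=> MB KE.
rewrite path_expectD path_expect_sum -(joint_path nu muB_prob).
have E (i : 'I_K) : path_expect nu n (fun w => ((i < (2 * reach 1%g w).+1)%N)%:R *
      expect (convolve_pow muB (switches (i%:Z - (reach 1%g w)%:Z : Zgroup) w))
       (fun b => N (wr_delta b))) =
   joint nu muB n (fun w h => ((i < (2 * reach 1%g w).+1)%N)%:R *
     N (wr_delta (rel_lamp h (i%:Z - (reach 1%g w)%:Z : Zgroup)))).
  rewrite (joint_lamp nu muB_prob n (fun w => i%:Z - (reach 1%g w)%:Z : Zgroup)
    (fun w b => ((i < (2 * reach 1%g w).+1)%N)%:R * N (wr_delta b))).
  by apply: eq_path_expect => w _; rewrite expectZ.
under eq_bigr do rewrite E.
rewrite -joint_sum -jointD expect_joint.
apply: (@ler_joint _ _ _ _ _ nu_prob muB_prob path_invariant) => //.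
- split=> //= [z|z y]; first by rewrite mulg1.
  by rewrite rel_lamp1 eqxx.
- by move=> *; exact: path_invariant_step.
move=> w h wn [ws bh rh]; set D := reach 1%g w.
have DK : ((2 * D).+1 <= K)%N.
  by rewrite KE ltnS leq_mul2l /= -wn; have := reach_le MB 1%g ws.
have hD : (absz (wr_base h : int) <= D)%N by have := bh 1%g; rewrite mul1g.
have rD (y : Zgroup) : rel_lamp h y != 1%g -> (absz (y : int) <= D)%N.
  by move=> /(rh 1%g); rewrite mul1g; congr (_ <= _)%N; exact: abszN.
apply: le_trans (seminorm_tour sN hD rD) _; rewrite addrC lerD2l.
rewrite (big_ord_widen _ (fun i => N (wr_delta (rel_lamp h (i%:Z - D%:Z : Zgroup)))) DK).
rewrite big_mkcond /=; apply: ler_sum => i _.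
by case: ifP; rewrite ?mul1r ?mul0r.
Qed.

(** With D the reach and t_y the numbers of switches, the mean length given the
   path is of order D plus the sum over |y| <= D of t_y^a, where n^a is the
   growth for the lamp group. As the t_y add up to 2n, the linear bound of
   [growth_chord] at sqrt n gives order D (sqrt n)^a, with D of order sqrt n. *)
Lemma drift_wreath : exists2 C : R, 0 < C & forall n,
  expect (convolve_pow (switch_walk_switch nu muB) n) N <=
  C * (n%:R / iter_sqrt j.+2 n%:R).
Proof.
have n0 := seminorm_ge0 sN.
have cA0 : 0 <= cA by rewrite addr_ge0.
have [M _ MB] := step_bound nu.
pose c1 : R := (1 + 4 * M%:R ^+ 2) / 2.
have c10 : 0 <= c1 by rewrite divr_ge0 // addr_ge0 // mulr_ge0 // sqr_ge0.
exists (cA * (7 * c1 + 2) + C' * (2 * c1 + 3)) => [|[|n]].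
- by rewrite ltr_wpDl ?mulr_ge0 ?mulr_gt0 //; lra.
- by rewrite expect_dirac1 seminorm1 // mul0r mulr0.
set K := (2 * (n.+1 * M)).+1.
apply: le_trans (joint_tour MB (erefl K)) _.
rewrite growthS //; set l := Num.sqrt _.
have l1 : 1 <= l by rewrite -[1]sqrtr1 ler_sqrt // ler1n.
have l0 : 0 < l by rewrite (lt_le_trans ltr01).
have l2 : l ^+ 2 = n.+1%:R by rewrite sqr_sqrtr.
set g := l / iter_sqrt j.+1 l.
have g1 : 1 <= g by exact: growth_ge1.
have g0 : 0 < g by rewrite (lt_le_trans ltr01).
apply: (@le_trans _ _ (path_expect nu n.+1 (fun w =>
   (2 * cA + C' * g * (1 + 2 * l)) + (7 * cA + 2 * C' * g) * (reach 1%g w)%:R))).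
  apply: ler_path_expect => // w wn; set D := reach 1%g w.
  pose f (i : nat) : Zgroup := (i%:Z - D%:Z : int).
  have S : \sum_(i < K) ((i < (2 * D).+1)%N)%:R * expect (convolve_pow muB (switches (f i) w))
       (fun b => N (wr_delta b)) <= C' * g * ((2 * D).+1%:R + (2 * n.+1)%:R / l).
    apply: (@le_trans _ _ (C' * g * \sum_(i < K) (((i < (2 * D).+1)%N)%:R + (switches (f i) w)%:R / l))).
      rewrite mulr_sumr; apply: ler_sum => i _.
      have T0 : 0 <= (switches (f i) w)%:R / l by rewrite divr_ge0 // ltW.
      have Cg : 0 <= C' * g by rewrite mulr_ge0 ?ltW.
      case: (ltnP i _) => _ /=; last by rewrite mul0r mulr_ge0 // addr_ge0.
      rewrite mul1r; apply: le_trans (lamp_drift _) _; rewrite -mulrA ler_pM2l //.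
      exact: growth_chord.
    rewrite ler_pM2l ?(mulr_gt0 C'0 g0) // big_split; apply: lerD; first exact: sum_ltn_le.
    rewrite -mulr_suml ler_pM2r ?invr_gt0 // -natr_sum ler_nat -wn.
    have uf : uniq [seq f i | i <- index_iota 0 K].
      rewrite map_inj_uniq ?iota_uniq // => i i' /(@addIr int (- D%:Z)) H.
      by apply/eqP; rewrite -eqz_nat H.
    by have := sum_switches_le w uf; rewrite big_map big_mkord.
  apply: le_trans (lerD (lexx _) S) _.
  have -> : (2 * n.+1)%:R / l = 2 * l by rewrite natrM -l2; field; rewrite gt_eqF.
  rewrite -[(2 * D).+1%:R]natr1 [(2 * D)%:R]natrM; lra.
rewrite path_expectD path_expect_cst // path_expectZ.
have c20 : 0 <= 7 * cA + 2 * C' * g by have := mulr_gt0 C'0 g0; lra.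
apply: le_trans (lerD (lexx _) (ler_wpM2l c20 (expect_reach nu_prob nu_sym MB _))) _.
rewrite -/l -/c1.
have lg : l <= l * g by rewrite ler_pMr.
have lg1 : 1 <= l * g by exact: le_trans lg.
have gl : g <= l * g by rewrite ler_pMl.
have h1 := ler_wpM2l cA0 lg1.
have h2 := ler_wpM2l (mulr_ge0 cA0 c10) lg.
have h3 := ler_wpM2l (ltW C'0) gl.
lra.
Qed.

End WreathDrift.

Theorem drift_growth (nu : nat -> {fsfun Zgroup -> R with 0}) j :
  (forall i, (i <= j)%N -> nondegenerate_step (nu i)) ->
  forall N : iter_wreath j -> R, seminorm N -> exists2 C : R, 0 < C & forall n,
  expect (convolve_pow (sws_walk nu j) n) N <= C * (n%:R / iter_sqrt j.+1 n%:R).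
Proof.
elim: j => [|j IH] hnu N sN; first exact: drift_int (hnu 0%N isT) sN.
have hnu' i (ij : (i <= j)%N) : nondegenerate_step (nu i) := hnu i (leqW ij).
have sNd : seminorm (N \o @wr_delta Zgroup (iter_wreath j)).
  by apply: seminorm_comp => //; [exact: wr_delta1|exact: wr_deltaM].
have [C' C'0 dr] := IH hnu' _ sNd.
have hj := hnu j.+1 (leqnn _).
exact: (drift_wreath hj (prob_sws_walk hnu') sN C'0 dr).
Qed.

End Drift.

(** * Almost invariance *)

Section WordLengths.
Context {R : realType} {G : groupType} (S : {fset G}).
Hypothesis hS : generates S.

Lemma word_length_attained g : exists2 w, word_of S w g & size w = word_length S g.
Proof.
rewrite /word_length; case: xgetP => [n _ [[w wg <-] _]|none]; first by exists w.
have ex : exists n, `[< word_lengths S g n >].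
  by have [w wg] := hS g; exists (size w); apply/asboolP; exists w.
case: (ex_minnP ex) => n /asboolP ng nmin; exfalso.
apply: (none n); split => // m mg; apply: nmin; exact/asboolP.
Qed.

Lemma word_length_min g w : word_of S w g -> (word_length S g <= size w)%N.
Proof.
move=> wg; rewrite /word_length; case: xgetP => [n _ [_ lb]|//].
by apply: lb; exists w.
Qed.

Lemma word_length_seminorm : seminorm (fun g => (word_length S g)%:R : R).
Proof.
split=> // [|x y].
  apply/eqP; rewrite pnatr_eq0 -leqn0; apply: (@word_length_min 1%g [::]).
  by split; rewrite ?big_nil.
have [[w [wS wx] ws] [u [uS uy] us]] := (word_length_attained x, word_length_attained y).
rewrite -natrD ler_nat -ws -us -size_cat; apply: word_length_min.
by split; rewrite ?all_cat ?wS // big_cat wx uy.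
Qed.

End WordLengths.

Section AlmostInvariance.
Context {R : realType} {G : groupType}.

(** The image of h under its own translation has at least half the mass of h, and
   a fixed translation does not identify different h; so the images retain at
   least half of the mass of V. *)
Lemma translated_mass (p : {fsfun G -> R with 0}) (V : set G) m (g : 'I_m -> G)
    (W : 'I_m -> G -> bool) (index : G -> 'I_m) :
  prob_meas p -> 2^-1 <= mass p V ->
  (forall h i, V h -> 0 < p h /\ `|p (h * g i)%g / p h - 1| <= 2^-1) ->
  (forall h, W (index h) (h * g (index h))%g) ->
  4^-1 <= \sum_(i < m) expect p (fun h => (W i h)%:R).
Proof.
move=> [p0 p1] pV inv ind.
have tr i : expect p (fun h => (W i h)%:R) >=
    \sum_(h <- finsupp p) p (h * g i)%g * (W i (h * g i)%g)%:R.
  pose Y := [fset (h * g i)%g | h in finsupp p]%fset.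
  rewrite (@expect_widen _ _ (Y `|` finsupp p)%fset) ?fsubsetUr //.
  apply: (@le_trans _ _ (\sum_(h <- (Y `|` finsupp p)%fset)
      (h \in Y)%:R * (p h * (W i h)%:R))); last first.
    by apply: ler_sum => h _; rewrite ler_piMl ?mulr_ge0 //; case: (h \in Y).
  rewrite -(big_fset_incl _ (fsubsetUl Y (finsupp p))) /=; last first.
    by move=> x _ /negPf ->; rewrite mul0r.
  rewrite /Y big_imfset /=; last by move=> x y _ _; exact: mulIg.
  rewrite big_seq [leRHS]big_seq; apply: ler_sum => h hp.
  have -> : (h * g i)%g \in [fset (h * g i)%g | h in finsupp p]%fset.
    by apply/imfsetP; exists h.
  by rewrite mul1r.
have half h : p h * (h \in V)%:R <= 2 * \sum_(i < m) p (h * g i)%g * (W i (h * g i)%g)%:R.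
  have s0 : 0 <= \sum_(i < m) p (h * g i)%g * (W i (h * g i)%g)%:R.
    by apply: sumr_ge0 => i _; rewrite mulr_ge0.
  case: (boolP (h \in V)) => [/set_mem hV|_]; last by rewrite mulr0 mulr_ge0.
  have [ph] := inv h (index h) hV; rewrite ler_norml => /andP[lo _].
  have {}lo : 2^-1 <= p (h * g (index h))%g / p h by lra.
  rewrite ler_pdivlMr // in lo.
  rewrite mulr1 (bigD1 (index h)) //= ind mulr1.
  have : 0 <= \sum_(i < m | i != index h) p (h * g i)%g * (W i (h * g i)%g)%:R.
    by apply: sumr_ge0 => i _; rewrite mulr_ge0.
  lra.
have : mass p V <= 2 * \sum_(i < m) expect p (fun h => (W i h)%:R).
  rewrite mass_expect /expect.
  apply: le_trans (ler_sum _ (fun h _ => half h)) _.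
  rewrite -mulr_sumr ler_pM2l // exchange_big /=.
  by apply: ler_sum => i _; exact: tr.
lra.
Qed.

End AlmostInvariance.

Section RadiusBound.
Context {R : realType}.

Lemma iter_sqrt_unbounded j (b : R) : exists X : R, forall x, X <= x -> b <= iter_sqrt j x.
Proof.
elim: j => [|j [X HX]]; first by exists b.
exists (Num.max X 0 ^+ 2) => x Xx /=; apply: HX.
have m0 : 0 <= Num.max X 0 by rewrite le_max lexx orbT.
apply: (@le_trans _ _ (Num.max X 0)); first by rewrite le_max lexx.
by rewrite -[leLHS](ger0_norm m0) -sqrtr_sqr ler_sqrt // (le_trans (sqr_ge0 _) Xx).
Qed.

Lemma iter_sqrt2 j : 1 <= iter_sqrt j (2 : R) <= 2.
Proof.
suff H (x : R) : 1 <= x <= 2 -> 1 <= iter_sqrt j x <= 2 by apply: H; rewrite ler1n lexx.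
elim: j x => [//|j IH] x /andP[x1 x2] /=; apply: IH.
rewrite -[X in X <= _]sqrtr1 ler_sqrt ?x1 ?(le_trans ler01) //=.
have -> : 2 = Num.sqrt (2 ^+ 2) :> R by rewrite sqrtr_sqr ger0_norm.
rewrite ler_sqrt ?sqr_ge0 //; lra.
Qed.

Variables (j : nat) (nu : nat -> {fsfun Zgroup -> R with 0}).
Hypothesis hnu : forall i, (i <= j.+1)%N -> nondegenerate_step (nu i).
Variable S : {fset iter_wreath j.+1}.
Hypothesis hS : generates S.

Let mu := sws_walk nu j.+1.
Let scale (n : nat) : R := iter_sqrt j.+2 n.+1%:R.

Definition invariant_at (n : nat) (e r : R) : Prop :=
  exists V : set (iter_wreath j.+1), 1 - e <= mass (convolve_pow mu n) V /\
      forall h g, V h -> (word_length S g)%:R <= r ->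
        0 < convolve_pow mu n h /\
        `|convolve_pow mu n (h * g)%g / convolve_pow mu n h - 1| <= e.

(** With k of order [scale n], let each h be multiplied so as to raise its maximal
   innermost lamp by k. All results lie in the sets where some site leads by k,
   which are unlikely, while their probabilities are comparable to those of h.
   The travel cost to the m sites is a constant, negligible against k. *)
Lemma not_invariant (c : R) : 0 < c -> exists N0 : nat, forall n r, (N0 <= n)%N ->
  c * scale n <= r -> ~ invariant_at n 2^-1 r.
Proof.
move=> c0; have [d [_ d_step d_free]] := step_direction (hnu (ltn0Sn j : 1 <= j.+1)%N).
have wl := @word_length_seminorm R _ S hS.
pose N g : R := (word_length S (at_current j g))%:R.
have sN : seminorm N.
  apply: (seminorm_comp _ _ wl); last exact: at_currentM.
  have := at_currentM j 1%g 1%g; rewrite mul1g => H.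
  by apply: (mulgI (at_current j 1%g)); rewrite -H mulg1.
have N0 := seminorm_ge0 sN.
pose C2 := N (wr_delta (1%:Z : Zgroup)); have C20 : 0 <= C2 by exact: N0.
have C21 : 0 < 2 * (C2 + 1) by lra.
(* Each unit of k costs C2 letters; c' spends half of the radius on them. *)
pose c' := c / (2 * (C2 + 1)); have c'0 : 0 < c' by exact: divr_gt0.
have c'20 : 0 < c' / 2 by exact: divr_gt0.
have e0 : 0 < 8^-1 :> R by [].
have [m [X0 [m0 X00 gap]]] := current_gap hnu d_step d_free c'20 e0.
pose C1 : R := \sum_(i < m) (N (wr_acting (d ^+ i)%g) + N (wr_acting (d ^+ i)%g)^-1%g).
have [X1 HX1] := iter_sqrt_unbounded j.+2 (2 / c' + 2 * C1 / c).
have [N1 HN1] : exists N1 : nat, X0 + `|X1| <= N1%:R.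
  by exists (Num.bound (X0 + `|X1|)); apply/ltW/archi_boundP; rewrite addr_ge0 // ltW.
exists N1 => n r N1n cr [V [mV inv]].
have nX : X0 + `|X1| <= n.+1%:R by apply: le_trans HN1 _; rewrite ler_nat leqW.
have s1 : 2 / c' + 2 * C1 / c <= scale n.
  by apply: HX1; have := ler_norm X1; lra.
have C10 : 0 <= C1 by apply: sumr_ge0 => i _; rewrite addr_ge0.
have s2 : 2 <= c' * scale n.
  rewrite mulrC -ler_pdivrMr //; apply: le_trans s1.
  by rewrite lerDl divr_ge0 ?mulr_ge0 // ltW.
have s3 : 2 * C1 <= c * scale n.
  rewrite mulrC [leRHS]mulrC -ler_pdivrMr // mulrC; apply: le_trans s1.
  by rewrite lerDr divr_ge0 // ltW.
have cs0 : 0 <= c' * scale n by rewrite (le_trans _ s2).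
have /Num.Theory.truncn_itv/andP[k1 k2] := cs0.
set k := Num.truncn _ in k1 k2; rewrite -natr1 in k2.
have k0 : (0 < k)%N by rewrite -(ltr_nat R); lra.
have ck : c' / 2 * iter_sqrt j.+2 n.+1%:R <= k%:R by rewrite -/(scale n); lra.
have kC2 : k%:R * C2 <= c * scale n / 2.
  have -> : c * scale n / 2 = c' * scale n * (C2 + 1).
    by rewrite /c'; field; rewrite gt_eqF //; lra.
  by apply: ler_pM => //; lra.
have nx : n%:R <= n.+1%:R :> R by rewrite ler_nat.
have X0n : X0 <= n.+1%:R by have := normr_ge0 X1; lra.
have {gap}gap := gap n.+1%:R n k X0n nx ck k0.
pose v (h : iter_wreath j.+1) : nat -> R := site_values d (rel_lamp (current h)).
pose g (i : 'I_m) := at_current j (add_at d i k).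
pose index h : 'I_m := [arg max_(i > Ordinal m0) v h i]%O.
have pp : prob_meas (convolve_pow mu n) by apply/prob_convolve_pow/prob_sws_walk.
have wg (i : 'I_m) : (word_length S (g i))%:R <= r.
  apply: le_trans cr; rewrite -/(N (add_at d i k)) /add_at.
  apply: le_trans (seminormM sN _ _) _.
  apply: le_trans (lerD (seminormM sN _ _) (lexx _)) _.
  apply: le_trans (lerD (lerD (lexx _) (seminormX _ _ sN)) (lexx _)) _.
  have : N (wr_acting (d ^+ i)%g) + N (wr_acting (d ^+ i)%g)^-1%g <= C1.
    by rewrite /C1 (bigD1 i) //= lerDl sumr_ge0 // => l _; rewrite addr_ge0.
  rewrite -/C2; lra.
have := @translated_mass R _ (convolve_pow mu n) V m g
  (fun i h => leads m (k%:R : R) (v h) i) index pp.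
have mV' : 2^-1 <= mass (convolve_pow mu n) V by lra.
move=> /(_ mV' (fun h i Vh => inv h (g i) Vh (wg i))) H.
suff : 4^-1 <= \sum_(i < m) expect (convolve_pow mu n) (fun h => (leads m (k%:R : R) (v h) i)%:R).
  move=> H'; have := le_trans H' gap; lra.
apply: H => h; apply/leadsP => l lm li; rewrite /v /g current_mul.
rewrite !(site_values_add_at d_free) eqxx (negPf li) addr0 lerD2r.
rewrite /index; case: arg_maxP => //= i _ imax.
exact: (imax (Ordinal lm)).
Qed.

Lemma invariant_at_mono n (e r r' : R) : r <= r' ->
  invariant_at n e r' -> invariant_at n e r.
Proof.
move=> rr' [V [mV inv]]; exists V; split => // h g Vh gr.
by apply: inv => //; exact: le_trans rr'.
Qed.

(** The largest admissible radius at precision one half, in units of [scale n] and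
   capped at one; the last summand keeps it positive. *)
Definition relative_radius (n : nat) : R :=
  sup [set t : R | t = 0 \/ [/\ 0 <= t, t <= 1 & invariant_at n 2^-1 (t * scale n)]]
  + n.+1%:R^-1.

Let scale_gt0 n : 0 < scale n. Proof. exact: iter_sqrt_gt0. Qed.

Let radius_set_sup n : has_sup
  [set t : R | t = 0 \/ [/\ 0 <= t, t <= 1 & invariant_at n 2^-1 (t * scale n)]].
Proof. by split; [exists 0; left|exists 1 => t [->|[]]]. Qed.

Lemma relative_radius_gt0 n : 0 < relative_radius n.
Proof.
apply: ltr_wpDl; last by rewrite invr_gt0.
by apply: ub_le_sup; [case: (radius_set_sup n)|left].
Qed.

Lemma relative_radius_bound n t : 0 <= t -> t <= 1 ->
  invariant_at n 2^-1 (t * scale n) -> t < relative_radius n.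
Proof.
move=> t0 t1 inv; rewrite /relative_radius.
apply: (@le_lt_trans _ _ (sup [set t : R | t = 0 \/
    [/\ 0 <= t, t <= 1 & invariant_at n 2^-1 (t * scale n)]])).
  by apply: ub_le_sup; [case: (radius_set_sup n)|right].
by rewrite ltrDl invr_gt0.
Qed.

Lemma relative_radius_cvg : relative_radius @ \oo --> 0.
Proof.
have sup0 : (fun n => sup [set t : R | t = 0 \/
    [/\ 0 <= t, t <= 1 & invariant_at n 2^-1 (t * scale n)]]) @ \oo --> 0.
  apply/cvgr0Pnorm_le => c c0.
  have [N0 HN0] := not_invariant c0.
  exists N0 => // n /= nN0; rewrite ger0_norm; last first.
    by apply: ub_le_sup; [case: (radius_set_sup n)|left].
  apply: ge_sup; first by exists 0; left.
  move=> t [->|[t0 t1 inv]]; first exact: ltW.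
  rewrite leNgt; apply/negP => ct; apply: (HN0 n _ nN0 _ inv).
  by rewrite ler_pM2r // ltW.
rewrite -[0]addr0; apply: cvgD => //; exact: cvg_harmonic.
Qed.

End RadiusBound.

Theorem corollary4p4 (R : realType) (j : nat) (hj : (1 <= j)%N)
  (nu : nat -> {fsfun Zgroup -> R with 0})
  (hnu : forall i, (i <= j)%N -> nondegenerate_step (nu i))
  (S : {fset iter_wreath j}) (hS : generates S) :
  let mu := sws_walk nu j in
  exists rho : nat -> R,
    [/\ forall n, 0 < rho n,
        (fun n => rho n / (n%:R / drift S mu n)) @ \oo --> 0 &
        radius_ai_preceq S mu rho].
Proof.
case: j hj hnu S hS => [//|j] _ hnu S hS mu.
pose t := relative_radius nu S.
pose scale (n : nat) : R := iter_sqrt j.+2 n.+1%:R.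
have scale0 n : 0 < scale n by exact: iter_sqrt_gt0.
have t0 n : 0 < t n by exact: relative_radius_gt0.
have tcvg : t @ \oo --> 0 by exact: relative_radius_cvg.
exists (fun n => t n * scale n); split => [n||].
- exact: mulr_gt0.
(* rho is t n times the scale, whose product with the drift is at most of
   order n; so rho is smaller than n / L(n) by the factor t n. *)
- have [C C0 dC] := drift_growth hnu (word_length_seminorm hS).
  have driftE n : drift S mu n =
      expect (convolve_pow mu n) (fun g => (word_length S g)%:R).
    by apply: eq_bigr => g _; rewrite mulrC.
  have drift0 n : 0 <= drift S mu n.
    by rewrite driftE; apply: expect_ge0 => //; exact/prob_convolve_pow/prob_sws_walk.
  have bnd n : t n * scale n / (n%:R / drift S mu n) <= 2 * C * t n.
    case: n => [|n].
      by rewrite mul0r invr0 mulr0 !mulr_ge0 // ltW.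
    rewrite invf_div -mulrA [leRHS]mulrC ler_pM2l //.
    have i0 : 0 < iter_sqrt j.+2 n.+1%:R :> R by exact: iter_sqrt_gt0.
    have dn : drift S mu n.+1 / n.+1%:R <= C / iter_sqrt j.+2 n.+1%:R.
      by rewrite ler_pdivrMr // driftE mulrAC -mulrA; exact: dC.
    have sn : scale n.+1 <= 2 * iter_sqrt j.+2 n.+1%:R.
      have /andP[_ s2] := @iter_sqrt2 R j.+2.
      apply: (@le_trans _ _ (iter_sqrt j.+2 (2 * n.+1%:R))).
        by apply: ler_iter_sqrt => //; rewrite -natrM ler_nat; lia.
      by rewrite iter_sqrtM // ler_pM2r.
    apply: le_trans (ler_pM (ltW (scale0 _)) (divr_ge0 (drift0 _) (ler0n _ _)) sn dn) _.
    by rewrite le_eqVlt; apply/orP; left; apply/eqP; field; rewrite gt_eqF.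
  apply: (@squeeze_cvgr _ _ _ _ (fun=> 0) (fun n => 2 * C * t n)).
  + apply: nearW => n; rewrite bnd andbT; apply: mulr_ge0; first exact/ltW/mulr_gt0.
    by rewrite invr_ge0 divr_ge0.
  + exact: cvg_cst.
  + by rewrite -[0](mulr0 (2 * C)); apply: cvgMr.
(* Where r' is at least twice rho, invariance at precision one half would exceed
   the largest admissible radius. *)
- move=> r' r'0 [phi [phi_incr blowup]] ai.
  have phi_ge n : (n <= phi n)%N.
    by elim: n => [//|n IH]; apply: leq_ltn_trans IH (phi_incr _ _ (ltnSn n)).
  have [N1 _ HN1] : \forall n \near \oo, t n <= 2^-1.
    by move/cvgr0Pnorm_le: tcvg => /(_ 2^-1) H; near=> n; rewrite -[t n]ger0_norm ?(ltW (t0 n)) //; near: n; apply: H.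
  have [N2 _ HN2] := ai 2^-1 ltac:(by rewrite invr_gt0).
  have [N3 _ HN3] : \forall n \near \oo, 2 <= r' (phi n) / (t (phi n) * scale (phi n)).
    by move/cvgryPge: blowup; exact.
  pose n := (N1 + N2 + N3)%N; pose m := phi n.
  have mn : (n <= m)%N by exact: phi_ge.
  have m1 : t m <= 2^-1 by apply: HN1; rewrite /=; lia.
  have m2 : invariant_at nu S m 2^-1 (r' m) by apply: HN2; rewrite /=; lia.
  have m3 : 2 <= r' m / (t m * scale m) by apply: HN3; rewrite /= /n; lia.
  rewrite ler_pdivlMr ?mulr_gt0 // mulrA in m3.
  have := @relative_radius_bound R j nu S m (2 * t m) _ _ (invariant_at_mono m3 m2).
  have := t0 m; rewrite -/t => tm /(_ _ _) H.
  have : 2 * t m < t m by apply: H; lra.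
  lra.
Unshelve. all: by end_near.
Qed.
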